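(* Let $2\leq p<\infty$ and $2\leq s<\infty$ be integers, let $\{2p\}$ denote the regular $2p$-gon, and let $\rho_0,\rho_1,\rho_2$ be the distinguished generators of $G(2^{\{2p\},\mathcal{G}(s)})$. Put $\tilde{\rho}_0:=\rho_0\rho_1\rho_0$ and $H:=H(2^{\{2p\},\mathcal{G}(s)})=\langle\tilde{\rho}_0,\rho_1,\rho_2\rangle$. Then the incidence system $\mathcal{H}(2^{\{2p\},\mathcal{G}(s)})=\Gamma(H;(H_i)_{i\in\{0,1,2\}})$ is a regular polytope of type $\{2p,2p\}$, whose automorphism group $H$ has order $(2s)^p\cdot 2p$ and is the quotient of the Coxeter group $[2p,2p]$ (with generators $\tilde{\rho}_0,\rho_1,\rho_2$ and defining relations $\tilde{\rho}_0^2=\rho_1^2=\rho_2^2=(\tilde{\rho}_0\rho_2)^{2p}=(\rho_2\rho_1)^{2p}=(\tilde{\rho}_0\rho_1)^2=id$) by the relations $$\big((\tilde{\rho}_0\rho_2)^{j-1}\tilde{\rho}_0\rho_1(\rho_2\rho_1)^{j-1}\big)^2=id\ \text{ for } 2\leq j\leq p-1,$$ $$\big((\tilde{\rho}_0\rho_2)^{p-1}\tilde{\rho}_0\rho_1(\rho_2\rho_1)^{p-1}\big)^s=id.$$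
   Context: C-groups and polytopes: a C-group of rank $m$ is a group $G$ with generating involutions $\rho_0,\dots,\rho_{m-1}$ satisfying $\langle\rho_i\mid i\in I\rangle\cap\langle\rho_j\mid j\in J\rangle=\langle\rho_k\mid k\in I\cap J\rangle$ for all $I,J\subseteq\{0,\dots,m-1\}$; it is a string C-group if $(\rho_i\rho_j)^2=id$ whenever $|i-j|\geq 2$. Abstract regular polytopes $\mathcal{P}$ of rank $m$ are in one-to-one correspondence with string C-groups $G(\mathcal{P})$ of rank $m$: the $i$-faces are the right cosets of $\langle\rho_j\mid j\neq i\rangle$, and vertices are the $0$-faces. The Schläfli type is $\{p_1,\dots,p_{m-1}\}$, $p_i$ being the order of $\rho_{i-1}\rho_i$. Construction of $2^{\mathcal{P},\mathcal{G}(s)}$: let $\mathcal{P}$ be a centrally symmetric regular $n$-polytope with group $G(\mathcal{P})=\langle\tau_0,\dots,\tau_{n-1}\rangle$, i.e. $G(\mathcal{P})$ has a proper central involution $\alpha$ fixing no vertex. Let $F_0$ be the base vertex, stabilized by $\langle\tau_1,\dots,\tau_{n-1}\rangle$. Let $W$ be the Coxeter group generated by involutions $\sigma_F$, one for each vertex $F$ of $\mathcal{P}$, with defining relations $\sigma_F^2=id$, $(\sigma_F\sigma_{F\alpha})^s=id$, and $(\sigma_F\sigma_{F'})^2=id$ for $F'\notin\{F,F\alpha\}$. The group $G(\mathcal{P})$ acts on $W$ by $\tau^{-1}\sigma_F\tau=\sigma_{F\tau}$. Then $2^{\mathcal{P},\mathcal{G}(s)}$ is the regular $(n+1)$-polytope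 with group $G(2^{\mathcal{P},\mathcal{G}(s)}):=W\rtimes G(\mathcal{P})=\langle\rho_0,\dots,\rho_n\rangle$, where $\rho_0:=\sigma_{F_0}$ and $\rho_i:=\tau_{i-1}$ for $1\leq i\leq n$. For the $2p$-gon, $G(\{2p\})=\langle\tau_0,\tau_1\rangle$ is dihedral of order $4p$ and $\alpha=(\tau_0\tau_1)^p$. Hypertopes and halving: for a group $H$ with subgroups $(H_i)_{i\in I}$, $\Gamma(H;(H_i)_{i\in I})$ is the incidence system whose elements of type $i$ are the right cosets of $H_i$, two elements being incident iff the cosets intersect. A flag is a set of pairwise incident elements and a chamber is a flag containing an element of every type. A regular hypertope is an incidence system in which every flag lies in a chamber (a geometry) and which is thin (every flag missing exactly one type lies in exactly two chambers), residually connected (every residue of rank at least $2$ has connected incidence graph) and flag-transitive (type-preserving automorphisms are transitive on flags of each given type). A regular hypertope obtained from a C-group with linear Coxeter diagram is a regular polytope, with generators taken in the order in which they occur in the diagram; here the order is $\tilde{\rho}_0,\rho_2,\rho_1$. For a regular $(n+1)$-polytope with group $\langle\rho_0,\dots,\rho_n\rangle$, the halving group is $\langle\tilde{\rho}_0,\rho_1,\dots,\rho_n\rangle$ with $\tilde{\rho}_0=\rho_0\rho_1\rho_0$; $H_i$ is the subgroup generated by all these generators except the $i$-th one ($\tilde{\rho}_0$ being number $0$). *)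

(* Defs.v *)
From HB Require Import structures.
From Stdlib Require Import Relation_Operators.
From mathcomp Require Import all_boot.
From mathcomp Require Import boolp classical_sets functions cardinality.
Set Implicit Arguments.
Unset Strict Implicit.
Unset Printing Implicit Defensive.

Local Open Scope quotient_scope.
Local Open Scope classical_set_scope.
Local Open Scope group_scope.

Section Groups.
Variable U : groupType.
Implicit Types (K : set U) (x : U).

Definition subgroup K : Prop :=
  [/\ K 1, forall x y, K x -> K y -> K (x * y) & forall x, K x -> K x^-1].

Definition generated (S : set U) : set U := smallest subgroup S.

Definition parabolic n (r : 'I_n -> U) (i : 'I_n) : set U :=
  generated [set r j | j in [set j | j != i]].

Definition normal_closure (S : set U) : set U :=
  smallest (fun K => subgroup K /\ forall x y, K x -> K (x ^ y)) S.

Definition rcoset K x : set U := [set k * x | k in K].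

Definition has_order x (k : nat) : Prop :=
  [/\ (0 < k)%N, x ^+ k = 1 & forall j, (0 < j < k)%N -> x ^+ j <> 1].

Lemma rcosetM K x y : rcoset (rcoset K x) y = rcoset K (x * y).
Proof.
apply/seteqP; split=> [_ [_ [k Kk <-] <-]|_ [k Kk <-]].
  by exists k; rewrite // mulgA.
by exists (k * x); [exists k | rewrite mulgA].
Qed.

Lemma rcoset1 K : rcoset K 1 = K.
Proof.
apply/seteqP; split=> [_ [k Kk <-]|k Kk]; first by rewrite mulg1.
by exists k; rewrite ?mulg1.
Qed.

End Groups.

(* The Coxeter group with generators indexed by I and relations             *)
(* (g_i g_j)^(m i j) = 1 for i <> j and g_i^2 = 1; an entry m i j = 0       *)
(* stands for infinity, i.e. no relation. As the generators are             *)
(* involutions, the group presented is the monoid of positive words modulo  *)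
(* the congruence generated by the relators, the inverse being reversal.    *)
Section Coxeter.
Variables (I : choiceType) (m : I -> I -> nat).

Inductive cox_eq : seq I -> seq I -> Prop :=
| cox_refl w : cox_eq w w
| cox_sym v w : cox_eq v w -> cox_eq w v
| cox_trans u v w : cox_eq u v -> cox_eq v w -> cox_eq u w
| cox_square i v w : cox_eq (v ++ [:: i; i] ++ w) (v ++ w)
| cox_braid i j v w : i <> j ->
    cox_eq (v ++ flatten (nseq (m i j) [:: i; j]) ++ w) (v ++ w).

Definition cox_eqb : rel (seq I) := fun v w => `[< cox_eq v w >].

Lemma cox_eqb_refl : reflexive cox_eqb.
Proof. by move=> w; apply/asboolP; apply: cox_refl. Qed.

Lemma cox_eqb_sym : symmetric cox_eqb.
Proof. by move=> v w; apply/asboolP/asboolP; apply: cox_sym. Qed.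

Lemma cox_eqb_trans : transitive cox_eqb.
Proof.
move=> v u w /asboolP uv /asboolP vw.
by apply/asboolP; apply: cox_trans uv vw.
Qed.

Canonical cox_equiv := EquivRel cox_eqb cox_eqb_refl cox_eqb_sym cox_eqb_trans.

Definition coxeter_group : Type := {eq_quot cox_equiv}.
HB.instance Definition _ := Choice.on coxeter_group.

Definition cox_word (w : seq I) : coxeter_group := \pi_{eq_quot cox_equiv} w.
Definition cox_repr (x : coxeter_group) : seq I :=
  repr (x : {eq_quot cox_equiv}).

Lemma cox_wordP v w : cox_word v = cox_word w <-> cox_eq v w.
Proof.
split=> [/eqquotP/asboolP //|vw].
by apply/eqquotP/asboolP.
Qed.

Lemma cox_word_eq v w : cox_eq v w -> cox_word v = cox_word w.
Proof. by move/cox_wordP. Qed.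

Lemma cox_reprK x : cox_word (cox_repr x) = x.
Proof. exact: (reprK (x : {eq_quot cox_equiv})). Qed.

Lemma cox_repr_word w : cox_eq (cox_repr (cox_word w)) w.
Proof. by apply/cox_wordP; rewrite cox_reprK. Qed.

Lemma cox_eq_catl u v w : cox_eq v w -> cox_eq (u ++ v) (u ++ w).
Proof.
elim=> {v w} [w|v w _|a b c _ h1 _ h2|i v w|i j v w ij].
- exact: cox_refl.
- exact: cox_sym.
- exact: cox_trans h1 h2.
- by rewrite !(catA u); apply: cox_square.
- by rewrite !(catA u); apply: cox_braid.
Qed.

Lemma cox_eq_catr u v w : cox_eq v w -> cox_eq (v ++ u) (w ++ u).
Proof.
elim=> {v w} [w|v w _|a b c _ h1 _ h2|i v w|i j v w ij].
- exact: cox_refl.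
- exact: cox_sym.
- exact: cox_trans h1 h2.
- by rewrite -!catA; apply: cox_square.
- by rewrite -!catA; apply: cox_braid.
Qed.

Lemma cox_eq_cat v v' w w' :
  cox_eq v v' -> cox_eq w w' -> cox_eq (v ++ w) (v' ++ w').
Proof.
by move=> vv' ww'; apply: cox_trans (cox_eq_catl _ ww'); apply: cox_eq_catr.
Qed.

Lemma cox_eq_revl w : cox_eq (rev w ++ w) [::].
Proof.
elim: w => [|i w IHw]; first exact: cox_refl.
rewrite rev_cons cat_rcons; apply: cox_trans IHw.
exact: (cox_square i (rev w) w).
Qed.

Lemma cox_eq_revr w : cox_eq (w ++ rev w) [::].
Proof. by rewrite -{1}(revK w); apply: cox_eq_revl. Qed.

Definition cox_one := cox_word [::].
Definition cox_mul x y := cox_word (cox_repr x ++ cox_repr y).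
Definition cox_inv x := cox_word (rev (cox_repr x)).

Lemma cox_mulE v w : cox_mul (cox_word v) (cox_word w) = cox_word (v ++ w).
Proof. by apply/cox_wordP/cox_eq_cat; apply: cox_repr_word. Qed.

Lemma cox_mulA : associative cox_mul.
Proof.
move=> x y z; rewrite -(cox_reprK x) -(cox_reprK y) -(cox_reprK z).
by rewrite !cox_mulE catA.
Qed.

Lemma cox_mul1 : left_id cox_one cox_mul.
Proof. by move=> x; rewrite -(cox_reprK x) cox_mulE. Qed.

Lemma cox_1mul : right_id cox_one cox_mul.
Proof. by move=> x; rewrite -(cox_reprK x) cox_mulE cats0. Qed.

Lemma cox_mulV : left_inverse cox_one cox_inv cox_mul.
Proof.
move=> x; rewrite -{2}(cox_reprK x) cox_mulE.
by apply/cox_wordP/cox_eq_revl.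
Qed.

Lemma cox_Vmul : right_inverse cox_one cox_inv cox_mul.
Proof.
move=> x; rewrite -{1}(cox_reprK x) cox_mulE.
by apply/cox_wordP/cox_eq_revr.
Qed.

HB.instance Definition _ := isGroup.Build coxeter_group
  cox_mulA cox_mul1 cox_1mul cox_mulV cox_Vmul.

Definition cox_gen (i : I) : coxeter_group := cox_word [:: i].

Lemma cox_wordM v w : cox_word (v ++ w) = cox_word v * cox_word w.
Proof. by rewrite -cox_mulE. Qed.

Lemma cox_genM i : cox_gen i * cox_gen i = 1.
Proof.
rewrite -cox_wordM -[1]/cox_one.
exact (cox_word_eq (cox_square i [::] [::])).
Qed.

Lemma cox_genX i j : i <> j -> (cox_gen i * cox_gen j) ^+ m i j = 1.
Proof.
move=> ij; have wX k : cox_word (flatten (nseq k [:: i; j])) =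
    (cox_gen i * cox_gen j) ^+ k.
  elim: k => [|k IHk]; first by [].
  by rewrite expgS -IHk /cox_gen -(cox_wordM [:: i]) -cox_wordM.
rewrite -wX -[1]/cox_one; apply: cox_word_eq.
by have := cox_braid [::] [::] ij; rewrite cats0.
Qed.

Lemma cox_ind (Q : coxeter_group -> Prop) :
  Q 1 -> (forall i x, Q x -> Q (cox_gen i * x)) -> forall x, Q x.
Proof.
move=> Q1 QM x; rewrite -(cox_reprK x); elim: (cox_repr x) => [|i w IHw] //.
by rewrite -cat1s cox_wordM; apply: QM.
Qed.

Definition cox_map (f : I -> I) (x : coxeter_group) : coxeter_group :=
  cox_word (map f (cox_repr x)).

Lemma cox_mapE (f : I -> I) : injective f ->
    (forall i j, m (f i) (f j) = m i j) ->
  forall w, cox_map f (cox_word w) = cox_word (map f w).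
Proof.
move=> f_inj fm w0; apply/cox_wordP; move: (cox_repr_word w0).
move: (cox_repr _) => v0; elim=> {v0 w0} [w|v w _|a b c _ h1 _ h2|i v w|i j v w ij].
- exact: cox_refl.
- exact: cox_sym.
- exact: cox_trans h1 h2.
- by rewrite !map_cat; apply: cox_square.
- rewrite !map_cat map_flatten map_nseq -fm; apply: cox_braid.
  by move/f_inj.
Qed.

End Coxeter.

(* The Coxeter matrix of the linear diagram with successive labels q; its   *)
(* group is [q_1, ..., q_(n-1)], with generators in diagram order.          *)
Definition string_matrix (n : nat) (q : seq nat) (i j : 'I_n) : nat :=
  if i == j then 1%N
  else if (i == j.+1 :> nat) || (j == i.+1 :> nat) then nth 0%N q (minn i j)
  else 2%N.

Definition string_coxeter (n : nat) (q : seq nat) : Type :=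
  coxeter_group (@string_matrix n q).
HB.instance Definition _ n q := Group.on (@string_coxeter n q).

Definition string_gen n q (i : 'I_n) : string_coxeter n q :=
  cox_gen (@string_matrix n q) i.

Record group_action (N G : groupType) := GroupAction {
  gact :> N -> G -> N;
  gactM : forall x y g, gact (x * y) g = gact x g * gact y g;
  gact1 : forall x, gact x 1 = x;
  gactA : forall x g h, gact x (g * h) = gact (gact x g) h }.

(* The pair (x, g) stands for x g, so that g^-1 x g = a x g.                *)
Definition semidirect (N G : groupType) (a : group_action N G) : Type :=
  (N * G)%type.

Section Semidirect.
Variables (N G : groupType) (a : group_action N G).
Local Notation S := (semidirect a).

HB.instance Definition _ := Choice.copy S (N * G)%type.

Definition sd_one : S := (1, 1).
Definition sd_mul (u v : S) : S := (u.1 * a v.1 u.2^-1, u.2 * v.2).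
Definition sd_inv (u : S) : S := ((a u.1 u.2)^-1, u.2^-1).

Lemma gact_one g : a 1 g = 1.
Proof. by apply: (mulgI (a 1 g)); rewrite -gactM !mulg1. Qed.

Lemma gactV x g : a x^-1 g = (a x g)^-1.
Proof. by apply: (mulgI (a x g)); rewrite -gactM !mulgV gact_one. Qed.

Lemma sd_mulA : associative sd_mul.
Proof.
move=> [x g] [y h] [z k]; rewrite /sd_mul /=; congr pair; last exact: mulgA.
by rewrite gactM -gactA -invgM mulgA.
Qed.

Lemma sd_mul1 : left_id sd_one sd_mul.
Proof. by move=> [x g]; rewrite /sd_mul /= invg1 gact1 !mul1g. Qed.

Lemma sd_1mul : right_id sd_one sd_mul.
Proof. by move=> [x g]; rewrite /sd_mul /= gact_one !mulg1. Qed.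

Lemma sd_mulV : left_inverse sd_one sd_inv sd_mul.
Proof. by move=> [x g]; rewrite /sd_mul /= invgK !mulVg. Qed.

Lemma sd_Vmul : right_inverse sd_one sd_inv sd_mul.
Proof.
by move=> [x g]; rewrite /sd_mul /= gactV -gactA !mulgV gact1 mulgV.
Qed.

HB.instance Definition _ := isGroup.Build S
  sd_mulA sd_mul1 sd_1mul sd_mulV sd_Vmul.

Definition sd_inl (x : N) : S := (x, 1).
Definition sd_inr (g : G) : S := (1, g).

End Semidirect.

(* G = <tau_0, ..., tau_n> is meant to be the group of a regular polytope P *)
(* and alpha its central symmetry; the construction itself only needs alpha *)
(* to be central.                                                           *)
Section Twisting.
Variables (G : groupType) (n : nat) (tau : 'I_n.+1 -> G) (alpha : G).
Hypothesis alpha_central : forall g, commute g alpha.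
Variable s : nat.

Definition vertex_stabilizer : set G := parabolic tau ord0.

Definition vertices : set (set G) := range (rcoset vertex_stabilizer).

Lemma vertices_rcoset (F : vertices) g : rcoset (val F) g \in vertices.
Proof.
case: F => /= F /set_mem[h _ <-]; apply/mem_set.
by exists (h * g) => //; rewrite rcosetM.
Qed.

Definition vertex_act (F : vertices) (g : G) : vertices :=
  exist _ (rcoset (val F) g) (vertices_rcoset F g).

Lemma base_vertex_subproof : vertex_stabilizer \in vertices.
Proof. by apply/mem_set; exists 1 => //; rewrite rcoset1. Qed.

Definition base_vertex : vertices :=
  exist _ vertex_stabilizer base_vertex_subproof.

Lemma vertex_actM F g h : vertex_act F (g * h) = vertex_act (vertex_act F g) h.
Proof. by apply: val_inj; rewrite /= rcosetM. Qed.

Lemma vertex_act1 F : vertex_act F 1 = F.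
Proof. by apply: val_inj; rewrite /= rcoset1. Qed.

Lemma vertex_act_inj g : injective (vertex_act^~ g).
Proof.
move=> E F EF; rewrite -(vertex_act1 E) -(mulgV g) vertex_actM EF.
by rewrite -vertex_actM mulgV vertex_act1.
Qed.

Definition twist_matrix (E F : vertices) : nat :=
  if F == E then 1%N else if F == vertex_act E alpha then s else 2%N.

Lemma twist_matrix_act g E F :
  twist_matrix (vertex_act E g) (vertex_act F g) = twist_matrix E F.
Proof.
rewrite /twist_matrix -vertex_actM alpha_central vertex_actM.
by rewrite !(inj_eq (@vertex_act_inj g)).
Qed.

Definition twist_W : groupType := coxeter_group twist_matrix.

Definition twist_act (x : twist_W) (g : G) : twist_W :=
  cox_map (vertex_act^~ g) x.

Lemma twist_actE w g :
  twist_act (cox_word _ w) g = cox_word _ (map (vertex_act^~ g) w).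
Proof.
by apply: cox_mapE; [apply: vertex_act_inj | apply: twist_matrix_act].
Qed.

Lemma twist_act_gen F g :
  twist_act (cox_gen _ F) g = cox_gen _ (vertex_act F g).
Proof. exact: twist_actE. Qed.

Lemma twist_actM x y g : twist_act (x * y) g = twist_act x g * twist_act y g.
Proof.
rewrite -(cox_reprK x) -(cox_reprK y) -cox_wordM !twist_actE map_cat.
exact: cox_wordM.
Qed.

Lemma twist_act1 x : twist_act x 1 = x.
Proof.
rewrite -(cox_reprK x) twist_actE (eq_map (g := id)) ?map_id // => F.
exact: vertex_act1.
Qed.

Lemma twist_actA x g h : twist_act x (g * h) = twist_act (twist_act x g) h.
Proof.
rewrite -(cox_reprK x) !twist_actE -map_comp; congr cox_word.
by apply: eq_map => F /=; rewrite vertex_actM.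
Qed.

Definition twist_action : group_action twist_W G :=
  GroupAction twist_actM twist_act1 twist_actA.

(* The group of 2^(P, G(s)) and its distinguished generators.               *)
Definition two_pow : Type := semidirect twist_action.
HB.instance Definition _ := Group.on two_pow.

Definition two_pow_gen (i : 'I_n.+2) : two_pow :=
  if unlift ord0 i is Some j then sd_inr twist_action (tau j)
  else sd_inl twist_action (cox_gen twist_matrix base_vertex).

End Twisting.

(* The dihedral group of order 4p of the regular 2p-gon.                    *)
Section Polygon.
Variable p : nat.

Definition polygon_group : groupType := string_coxeter 2 [:: 2 * p]%N.
Definition polygon_gen (i : 'I_2) : polygon_group := string_gen [:: 2 * p]%N i.

Definition polygon_alpha : polygon_group :=
  (polygon_gen ord0 * polygon_gen ord_max) ^+ p.

Lemma polygon_alpha_central g : commute g polygon_alpha.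
Proof.
pose a := polygon_gen ord0; pose b := polygon_gen ord_max.
have aa : a * a = 1 by apply: cox_genM.
have bb : b * b = 1 by apply: cox_genM.
have baV : b * a = (a * b)^-1.
  by apply: (mulgI (a * b)); rewrite mulgV mulgA -(mulgA a) bb mulg1.
have ab2 : (a * b) ^+ (2 * p) = 1 by apply: cox_genX.
have baE : (b * a) ^+ p = (a * b) ^+ p.
  rewrite baV expVgn; apply: (mulgI ((a * b) ^+ p)).
  by rewrite mulgV -expgnDr addnn -mul2n ab2.
have aX k : a * (b * a) ^+ k = (a * b) ^+ k * a.
  elim: k => [|k IHk]; first by rewrite !expg0 mulg1 mul1g.
  by rewrite expgSr mulgA IHk -!mulgA (expgSr (a * b)) -!mulgA.
have bX k : b * (a * b) ^+ k = (b * a) ^+ k * b.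
  elim: k => [|k IHk]; first by rewrite !expg0 mulg1 mul1g.
  by rewrite expgSr mulgA IHk -!mulgA (expgSr (b * a)) -!mulgA.
have gen_comm i : commute (polygon_gen i) polygon_alpha.
  rewrite /commute /polygon_alpha -/a -/b; case: (unliftP ord0 i) => [j ->|->].
    have -> : lift ord0 j = ord_max by apply: val_inj; rewrite /= (ord1 j).
    by rewrite -/b bX baE.
  by rewrite -/a -{1}baE aX.
apply: (@cox_ind _ _ (commute^~ polygon_alpha)) => [|i x cx].
  by rewrite /commute mul1g mulg1.
by rewrite /commute -mulgA cx !mulgA; congr (_ * _); apply: gen_comm.
Qed.

End Polygon.

Definition two_pow_polygon (p s : nat) : groupType :=
  two_pow (@polygon_gen p) (@polygon_alpha_central p) s.
Definition two_pow_polygon_gen p s (i : 'I_3) : two_pow_polygon p s :=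
  two_pow_gen (@polygon_gen p) (@polygon_alpha_central p) s i.

(* Elements of the same type are expected to be incident iff equal, as is   *)
(* the case for cosets of subgroups.                                        *)
Record incidence_system (I : Type) := IncidenceSystem {
  ielt :> Type;
  itype : ielt -> I;
  incident : ielt -> ielt -> Prop }.

Section Hypertope.
Variables (I : Type) (X : incidence_system I).
Implicit Types (F C : set X) (phi : X -> X).

Definition types F : set I := [set itype x | x in F].
Definition flag F : Prop := forall x y, F x -> F y -> incident x y.
Definition chamber F : Prop := flag F /\ types F = setT.

Definition geometry : Prop :=
  forall F, flag F -> exists2 C, chamber C & F `<=` C.

Definition thin : Prop := forall F i, flag F -> types F = [set~ i] ->
  exists C1 C2, C1 <> C2 /\
    [set C | chamber C /\ F `<=` C] = [set C1; C2].

Definition residue F : set X :=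
  [set x | ~ F x /\ forall y, F y -> incident x y].

Definition connected F : Prop := forall x y, F x -> F y ->
  clos_refl_trans _ (fun u v => [/\ F u, F v & incident u v]) x y.

(* The rank of the residue of F is the number of types missing from F.      *)
Definition residually_connected : Prop := forall F i j, flag F ->
  i <> j -> ~ types F i -> ~ types F j -> connected (residue F).

Definition automorphism phi : Prop :=
  [/\ bijective phi, forall x, itype (phi x) = itype x &
      forall x y, incident (phi x) (phi y) <-> incident x y].

Definition flag_transitive : Prop := forall F1 F2, flag F1 -> flag F2 ->
  types F1 = types F2 -> exists2 phi, automorphism phi & phi @` F1 = F2.

Definition regular_hypertope : Prop :=
  [/\ geometry, thin, residually_connected & flag_transitive].

End Hypertope.

Section CosetGeometry.
Variables (U : groupType) (I : Type) (H : set U) (Hi : I -> set U).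

Definition coset_elements : set (I * set U) :=
  [set x | exists2 h, H h & x.2 = rcoset (Hi x.1) h].

Definition coset_geometry : incidence_system I :=
  {| ielt := coset_elements;
     itype := fun x => (val x).1;
     incident := fun x y => (val x).2 `&` (val y).2 !=set0 |}.

(* Right multiplication is an isomorphism from H onto the group of type-    *)
(* preserving automorphisms of the coset geometry.                          *)
Definition right_mult (h : U) (phi : coset_geometry -> coset_geometry) : Prop :=
  forall x, val (phi x) = ((val x).1, rcoset (val x).2 h).

Definition automorphism_group_is_right_mult : Prop :=
  (forall h, H h -> exists2 phi, automorphism phi & right_mult h phi) /\
  (forall phi, automorphism phi -> exists! h, H h /\ right_mult h phi).

End CosetGeometry.

Section CGroup.
Variables (U : groupType) (n : nat) (r : 'I_n -> U).

Definition C_group : Prop :=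
  (forall i, r i <> 1 /\ r i * r i = 1) /\
  forall J K : set 'I_n, generated (r @` J) `&` generated (r @` K) =
    generated (r @` (J `&` K)).

Definition string_C_group : Prop :=
  C_group /\ forall i j : 'I_n, (i.+1 < j)%N -> (r i * r j) ^+ 2 = 1.

Definition schlafli_type (q : seq nat) : Prop :=
  (size q).+1 = n /\ forall i j : 'I_n, j = i.+1 :> nat ->
    has_order (r i * r j) (nth 0%N q i).

Definition hypertope_of : incidence_system 'I_n :=
  coset_geometry (generated (range r)) (parabolic r).

End CGroup.

(* The incidence system of the generators r is a regular polytope of type   *)
(* {q_1, ..., q_(n-1)}; the linear diagram lists the generators in the      *)
(* order r (e 0), r (e 1), ...                                              *)
Definition regular_polytope (U : groupType) (n : nat) (r : 'I_n -> U)
    (e : 'I_n -> 'I_n) (q : seq nat) : Prop :=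
  [/\ bijective e, regular_hypertope (hypertope_of r),
      string_C_group (r \o e) & schlafli_type (r \o e) q].

Definition halving_gen (U : groupType) (n : nat) (rho : 'I_n.+2 -> U)
    (i : 'I_n.+2) : U :=
  if i == ord0 then rho ord0 * rho (inord 1) * rho ord0 else rho i.

(* Main.v *)
From HB Require Import structures.
From Stdlib Require Import Relation_Operators.
Require Import Defs.
From mathcomp Require Import all_boot.
From mathcomp Require Import ssralg zmodp.
From mathcomp Require Import boolp classical_sets functions cardinality.
From mathcomp Require Import zify.

Set Implicit Arguments.
Unset Strict Implicit.
Unset Printing Implicit Defensive.

Local Open Scope classical_set_scope.
Local Open Scope group_scope.
Local Open Scope card_scope.

(** Write a and b for the generators of the group G of the 2p-gon, r for the
rotation ab, and S for the reflection in the base vertex, which b fixes. The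
halving group H is generated by SaS, a and b, and conjugation by S exchanges
the first two and fixes b. Everything follows from this symmetry.

Polytope. The maximal parabolic subgroups of H are G = <a, b>, SGS = <SaS, b>
and the four-group <SaS, a>. As distinct vertices have distinct reflections
([sigma_inj]), SgS belongs to G only if g fixes the base vertex
([tau_sigma0_conj]); so two maximal parabolics meet in the group of order two
of their common generator. In rank three this is the intersection property
([rank3_meet]). As the diagram is linear, every flag of the coset geometry has
a common point h ([rank3_flag]), that is, consists of cosets P_i h. Then flags
are translates of parts of the base chamber, and thinness, residual
connectedness, flag-transitivity and the determination of the automorphisms
are read off from the intersections of the P_i
([coset_geometry_hypertope], [coset_geometry_automorphisms]).

Order. The group W is the product of p dihedral groups of order 2s, one for
each pair of antipodal vertices ([coordsK], [of_coordsK]), and G is dihedral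
of order 4p. The group H consists of the elements with an even number of
reflections ([halving_parity]), which form half of the semidirect product.

Presentation. Up to conjugation, the word w_j represents the product of the
reflections in the base vertex and in the j-th vertex ([relator_two_pow]); this
product has order 2 for j < p and s for j = p, so the relations hold in H.
Conversely, let C be the Coxeter group [2p,2p] and N the normal closure of the
relators. The reversal of the diagram of C inverts every w_j, so C/N extends by
an involution t which exchanges the end generators and commutes with the middle
one. By the relators, the conjugates of t by the image of G satisfy the defining
relations of W ([reflection_imageX]). This gives a homomorphism from the
semidirect product of W and G to the extension whose composite with the map
from C onto H is the canonical map from C ([two_pow_morph_halving]); hence the
kernel of the map from C onto H is N. *)

(** * Subgroups, generation and cosets *)

Section Subgroups.
Variable U : groupType.
Implicit Types (K S : set U) (x y : U).

Lemma sub_generated S : S `<=` generated S.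
Proof. by move=> x Sx K [_]; apply. Qed.

Lemma generated_subgroup S : subgroup (generated S).
Proof.
split=> [K [[K1 _ _] _] // |x y Sx Sy K KS|x Sx K KS].
  by case: (KS) => -[_ KM _] _; apply: KM; [apply: Sx | apply: Sy].
by case: (KS) => -[_ _ KV] _; apply: KV; apply: Sx.
Qed.

Lemma generated_sub S K : subgroup K -> S `<=` K -> generated S `<=` K.
Proof. by move=> Kg SK; apply: smallest_sub. Qed.

Lemma generatedS S T : S `<=` T -> generated S `<=` generated T.
Proof.
move=> ST; apply: generated_sub (generated_subgroup T) _.
exact: subset_trans ST (@sub_generated T).
Qed.

Lemma subgroup1 K : subgroup K -> K 1. Proof. by case. Qed.
Lemma subgroupM K x y : subgroup K -> K x -> K y -> K (x * y).
Proof. by case=> _ + _; apply. Qed.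
Lemma subgroupV K x : subgroup K -> K x -> K x^-1.
Proof. by case=> _ _; apply. Qed.

(** An involution is its own inverse, so a subgroup generated by involutions is
reached from 1 by left multiplications by the generators alone. *)
Lemma generated_ind S (P : U -> Prop) :
    (forall x, S x -> x * x = 1) -> P 1 ->
    (forall x y, S x -> P y -> P (x * y)) ->
  forall x, generated S x -> P x.
Proof.
move=> S2 P1 PM.
pose K := [set x | (forall y, P y -> P (x * y)) /\
                   (forall y, P y -> P (x^-1 * y))].
suff SK : generated S `<=` K by move=> x /SK [] /(_ 1 P1); rewrite mulg1.
apply: generated_sub => [|x Sx].
  split=> [|x y [xP xVP] [yP yVP]|x [xP xVP]].
  - by split=> y; rewrite ?invg1 mul1g.
  - by split=> z Pz; rewrite ?invgM -mulgA; [apply/xP/yP | apply/yVP/xVP].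
  - by split=> y; rewrite ?invgK; [apply: xVP | apply: xP].
have xV : x^-1 = x by apply: mulg1_eq; apply: S2.
by split=> y; rewrite ?xV; apply: PM.
Qed.

Lemma rcosetP K x y : rcoset K x y <-> K (y * x^-1).
Proof.
split=> [[k Kk <-]|Kyx]; first by rewrite mulgK.
by exists (y * x^-1) => //; rewrite mulgVK.
Qed.

Lemma rcoset_refl K x : subgroup K -> rcoset K x x.
Proof. by move=> Kg; apply/rcosetP; rewrite mulgV; apply: subgroup1. Qed.

Lemma rcoset_eqP K x y : subgroup K -> rcoset K x = rcoset K y <-> K (x * y^-1).
Proof.
move=> Kg; split=> [xy|Kxy].
  by apply/rcosetP; rewrite -xy; apply: rcoset_refl.
apply/seteqP; split=> z /rcosetP Kz; apply/rcosetP.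
  by rewrite -(mulgVK x z) -mulgA; apply: subgroupM.
rewrite -(mulgVK y z) -mulgA; apply: subgroupM => //.
by rewrite -invgF; apply: subgroupV.
Qed.

Lemma rcoset_mem K x y : subgroup K -> rcoset K x y -> rcoset K x = rcoset K y.
Proof.
move=> Kg /rcosetP Kyx; apply/rcoset_eqP => //.
by rewrite -invgF; apply: subgroupV.
Qed.

End Subgroups.

(** * Words in two involutions *)

Lemma commute_involutions (U : groupType) (x y : U) :
  x * x = 1 -> y * y = 1 -> (x * y) ^+ 2 = 1 -> commute x y.
Proof.
move=> xx yy xy2; apply: (mulIg (x * y)).
by rewrite -expg2 xy2 mulgA -(mulgA y) xx mulg1 yy.
Qed.

Lemma involutions_swapX (U : groupType) (x y : U) k :
  x * x = 1 -> y * y = 1 -> (x * y) ^+ k = 1 -> (y * x) ^+ k = 1.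
Proof.
move=> xx yy xyk; rewrite -(invgK (y * x)) invgM (mulg1_eq xx) (mulg1_eq yy).
by rewrite expVgn xyk invg1.
Qed.

(** The shift that turns the powers of [x0 * x2] in the relators into powers of
[x2 * x0]. *)
Lemma expg_swap (U : groupType) (x y : U) k :
  (x * y) ^+ k.+1 = x * (y * x) ^+ k * y.
Proof.
elim: k => [|k IHk]; first by rewrite expg1 expg0 mulg1.
by rewrite expgS IHk (expgS (y * x)) !mulgA.
Qed.

(** * Coset geometries whose flags have a common point *)

Opaque generated.

Section CosetGeometry.
Variables (U : groupType) (n : nat) (r : 'I_n -> U).
Local Notation H := (generated (range r)).
Local Notation P := (parabolic r).
Local Notation X := (hypertope_of r).
Implicit Types (F C : set X) (x y : X) (g h z : U).

Lemma parabolicS i : P i `<=` H.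
Proof. by apply: generatedS; apply: image_subset. Qed.

Lemma parabolic_subgroup i : subgroup (P i).
Proof. exact: generated_subgroup. Qed.

Lemma parabolic_gen i j : i != j -> P i (r j).
Proof. by move=> ij; apply: sub_generated; exists j; rewrite //= eq_sym. Qed.

(** The elements of [H] serve as chambers: [h] stands for the set of all cosets
[P i * h], and [on h x] says that [x] is one of them. *)
Definition on h x : Prop := (val x).2 h.

Lemma on_H h x : on h x -> H h.
Proof.
case: x => -[i A] Ai; case: (set_mem Ai) => /= g Hg AE.
rewrite /on /= AE => /rcosetP Phg.
have Hgrp := generated_subgroup (range r).
rewrite -(mulgVK g h); apply: (subgroupM Hgrp) => //.
exact: (parabolicS Phg).
Qed.

Lemma on_val h x : on h x -> val x = (itype x, rcoset (P (itype x)) h).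
Proof.
case: x => -[i A] Ai; case: (set_mem Ai) => /= g Hg AE.
rewrite /on /= AE => Ah.
by rewrite (rcoset_mem (@parabolic_subgroup i) Ah).
Qed.

Lemma on_inj h x y : on h x -> on h y -> itype x = itype y -> x = y.
Proof.
by move=> hx hy xy; apply: val_inj; rewrite (on_val hx) (on_val hy) xy.
Qed.

Lemma on_ex h i : H h -> exists2 x : X, itype x = i & on h x.
Proof.
move=> Hh; have Xi : (i, rcoset (P i) h) \in coset_elements H P.
  by apply/mem_set; exists h.
exists (exist (fun A => A \in coset_elements H P) _ Xi) => //.
exact/rcoset_refl/parabolic_subgroup.
Qed.

Lemma on_some x : exists h, on h x.
Proof.
case: x => -[i A] Ai; case: (set_mem Ai) => /= g Hg AE.
exists g; rewrite /on /= AE; exact: rcoset_refl (@parabolic_subgroup i).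
Qed.

(** Chambers sharing the element [x] differ by a left factor in the parabolic
subgroup of the type of [x]. *)
Lemma on_mul g h x : on h x -> on (g * h) x <-> P (itype x) g.
Proof.
move=> hx; rewrite /on (on_val hx) /=; split=> [/rcosetP|Pg].
  by rewrite mulgK.
by apply/rcosetP; rewrite mulgK.
Qed.

Lemma on_incident h x y : on h x -> on h y -> incident x y.
Proof. by move=> hx hy; exists h; split. Qed.

Lemma incidentP x y : incident x y <-> exists2 h, on h x & on h y.
Proof. by split=> [[h [hx hy]]|[h hx hy]]; [exists h | exists h; split]. Qed.

Lemma chamber_on_point h : H h -> chamber [set x | on h x].
Proof.
move=> Hh; split=> [x y /=|]; first exact: on_incident.
by rewrite -subTset => i _; have [x xi hx] := on_ex i Hh; exists x.
Qed.

Lemma right_mult_automorphism g : H g ->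
  exists2 phi : X -> X, automorphism phi & right_mult g phi.
Proof.
have Hgrp := generated_subgroup (range r).
have XM (x : X) h : H h ->
    ((val x).1, rcoset (val x).2 h) \in coset_elements H P.
  move=> Hh; have [k kx] := on_some x; apply/mem_set; exists (k * h) => /=.
    by apply: (subgroupM Hgrp) => //; apply: on_H kx.
  by rewrite -rcosetM (on_val kx).
move=> Hg; have HVg : H g^-1 by apply: (subgroupV Hgrp).
pose phi h (Hh : H h) (x : X) : X :=
  exist (fun A => A \in coset_elements H P) _ (XM x h Hh).
exists (phi g Hg) => //; split=> //.
  exists (phi g^-1 HVg) => x; apply: val_inj;
    by rewrite /= rcosetM ?mulgV ?mulVg rcoset1; case: (val x).
move=> x y; split=> [[_ [/= [h hx <-] [h' hy /mulIg hh']]]|[h [hx hy]]].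
  by exists h; split=> //; rewrite -hh'.
by exists (h * g); split; exists h.
Qed.

Hypothesis r2 : forall i, r i * r i = 1.
Hypothesis r_notin : forall i, ~ P i (r i).
(* The intersection property in the form that the geometry uses: a parabolic
   subgroup is the meet of the maximal ones that contain it. *)
Hypothesis meetP : forall (J : set 'I_n) g,
  H g -> (forall l, ~ J l -> P l g) -> generated (r @` J) g.
Hypothesis flagP : forall F, flag F -> exists2 h, H h & F `<=` on h.

Lemma meet_all g : H g -> (forall l, P l g) -> g = 1.
Proof.
move=> Hg Pg; have : generated (r @` set0) g by apply: meetP.
by elim/generated_ind => // [x [] //|x y []].
Qed.

Lemma meet_all_but k g : H g -> (forall l, l != k -> P l g) -> g = 1 \/ g = r k.
Proof.
move=> Hg Pg; have : generated (r @` [set k]) g.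
  by apply: meetP => // l /= /eqP; apply: Pg.
elim/generated_ind => [_ [_ -> <-] // ||_ y [_ -> <-]]; first by left.
by case=> ->; rewrite ?r2 ?mulg1; [right | left].
Qed.

Lemma range_gen k : H (r k).
Proof. by apply: sub_generated; exists k. Qed.

Lemma chamberP C : chamber C -> exists2 h, H h & C = [set x | on h x].
Proof.
case=> Cflag CT; have [h Hh Ch] := flagP Cflag; exists h => //.
apply/seteqP; split=> // x hx; have : types C (itype x) by rewrite CT.
by case=> y Cy yx; rewrite -(on_inj (Ch _ Cy) hx yx).
Qed.

Lemma coset_geometry_geometry : geometry X.
Proof.
move=> F /flagP[h Hh Fh]; exists [set x | on h x] => //.
exact: chamber_on_point.
Qed.

(** If a chamber [z] shares with [h] all elements but the one of type [i], then
[z * h^-1] lies in every [P l] with [l != i], hence is 1 or [r i]. *)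
Lemma coset_geometry_thin : thin X.
Proof.
have Hgrp := generated_subgroup (range r).
move=> F i Fflag FT; have [h Hh Fh] := flagP Fflag.
have Hrh : H (r i * h) by apply: (subgroupM Hgrp) => //; apply: range_gen.
have Frh : F `<=` on (r i * h).
  move=> x Fx; apply/(on_mul _ (Fh _ Fx)); apply: parabolic_gen.
  have : types F (itype x) by exists x.
  by rewrite FT => /= /eqP.
exists [set x | on h x], [set x | on (r i * h) x]; split.
  move=> hrh; have [x xi hx] := on_ex i Hh.
  have : [set x | on (r i * h) x] x by rewrite -hrh.
  by move/(on_mul _ hx); rewrite xi; apply: r_notin.
apply/seteqP; split=> C /=; last first.
  by case=> ->; split=> //; apply: chamber_on_point.
case=> /chamberP[z Hz ->] Fz.
have : z * h^-1 = 1 \/ z * h^-1 = r i.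
  apply: meet_all_but => [|l li].
    by apply: (subgroupM Hgrp) => //; apply: (subgroupV Hgrp).
  have : types F l by rewrite FT; apply/eqP.
  case=> x Fx <-; apply/(on_mul _ (Fh _ Fx)); rewrite mulgVK.
  exact: Fz Fx.
by case=> zh; rewrite -(mulgVK h z) zh ?mul1g; [left | right].
Qed.

(** Let [J] be the set of types missing from a flag of the chamber [h]. Its
residue consists of the elements of types in [J] of the chambers [g * h], with
[g] in the parabolic subgroup of [J]. Removing the first generator [r k] of [g]
changes only the element of type [k], and [J] contains a type other than [k],
whose element joins the two chambers; induction leads back to [h]. *)
Lemma coset_geometry_residually_connected : residually_connected X.
Proof.
have Hgrp := generated_subgroup (range r).
move=> F i j Fflag ij Fi Fj; have [h Hh Fh] := flagP Fflag.
pose J := ~` types F.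
pose E := (fun u v => [/\ residue F u, residue F v & incident u v]).
have resJ g x : generated (r @` J) g -> on (g * h) x -> J (itype x) ->
    residue F x.
  move=> Jg gx Jx; split=> [Fx|y Fy]; first by apply: Jx; exists x.
  apply: on_incident gx _; apply/(on_mul _ (Fh _ Fy)).
  move: Jg; apply: generatedS; apply: image_subset => k Jk /=.
  by apply/eqP=> ky; apply: Jk; exists y.
have [x0 x0i hx0] := on_ex i Hh.
have Jx0 : J (itype x0) by rewrite x0i.
have x0P g : generated (r @` J) g -> forall x, on (g * h) x -> J (itype x) ->
    clos_refl_trans _ E x0 x /\ clos_refl_trans _ E x x0.
  move=> Jg; suff [] : generated (r @` J) g /\ forall x, on (g * h) x ->
      J (itype x) -> clos_refl_trans _ E x0 x /\ clos_refl_trans _ E x x0 by [].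
  have Jgrp := generated_subgroup (r @` J).
  move: Jg; elim/generated_ind => [_ [k _ <-]||_ g' [k Jk <-] [Jg' IH]].
  - exact: r2.
  - split=> [|x]; first exact: (subgroup1 Jgrp).
    rewrite mul1g => hx Jx.
    have J1 : generated (r @` J) 1 by apply: (subgroup1 Jgrp).
    have x0R : residue F x0 by apply: (resJ 1) => //; rewrite mul1g.
    have xR : residue F x by apply: (resJ 1) => //; rewrite mul1g.
    split; apply: rt_step; split=> //; first exact: on_incident hx0 hx.
    exact: on_incident hx hx0.
  - have Jk' : generated (r @` J) (r k) by apply: sub_generated; exists k.
    have Jkg : generated (r @` J) (r k * g') by apply: (subgroupM Jgrp).
    split=> // x kgx Jx.
    have [k' Jk'' kk'] : exists2 k', J k' & k' != k.
      case: (eqVneq i k) => [<-|]; last by exists i.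
      by exists j => //; apply/eqP/nesym.
    have Hgh : H (g' * h).
      apply: (subgroupM Hgrp) => //; move: Jg'; apply: generatedS.
      by apply: image_subset.
    have [y yk' gy] := on_ex k' Hgh.
    have kgy : on (r k * g' * h) y.
      by rewrite -mulgA; apply/(on_mul _ gy); apply: parabolic_gen; rewrite yk'.
    have Jy : J (itype y) by rewrite yk'.
    have [x0y yx0] := IH y gy Jy.
    have yR := resJ _ _ Jkg kgy Jy; have xR := resJ _ _ Jkg kgx Jx.
    split; [apply: rt_trans x0y _ | apply: rt_trans yx0]; apply: rt_step.
      by split=> //; apply: on_incident kgy kgx.
    by split=> //; apply: on_incident kgx kgy.
have resP x : residue F x ->
    clos_refl_trans _ E x0 x /\ clos_refl_trans _ E x x0.
  case=> Fx xF.
  have xflag : flag (F `|` [set x]).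
    move=> u v [Fu|->] [Fv|->]; [exact: Fflag | | exact: xF |].
      by have /incidentP[k kx ku] := xF _ Fu; apply/incidentP; exists k.
    by have [k kx] := on_some x; apply/incidentP; exists k.
  have [z Hz Fxz] := flagP xflag.
  have zx : on z x by apply: Fxz; right.
  have zhx : on (z * h^-1 * h) x by rewrite mulgVK.
  apply: x0P zhx _ => [|[y Fy yx]]; last first.
    apply: Fx; rewrite -(on_inj _ zx yx : y = x) //.
    by apply: Fxz; left.
  apply: meetP => [|l].
    by apply: (subgroupM Hgrp) => //; apply: (subgroupV Hgrp).
  move/contrapT => -[y Fy <-]; apply/(on_mul _ (Fh _ Fy)); rewrite mulgVK.
  by apply: Fxz; left.
move=> x y /resP[_ xx0] /resP[x0y _]; exact: rt_trans xx0 x0y.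
Qed.

(** Flags of the same types in the chambers [h1] and [h2] correspond under the
right multiplication by [h1^-1 * h2]. *)
Lemma coset_geometry_flag_transitive : flag_transitive X.
Proof.
have Hgrp := generated_subgroup (range r).
move=> F1 F2 /flagP[h1 Hh1 F1h] /flagP[h2 Hh2 F2h] F12.
have Hg : H (h1^-1 * h2).
  by apply: (subgroupM Hgrp) => //; apply: (subgroupV Hgrp).
have [phi phiA phiM] := right_mult_automorphism Hg; exists phi => //.
have phi_on x : F1 x -> on h2 (phi x).
  move=> /F1h h1x; rewrite /on phiM /=.
  by exists h1; rewrite ?mulVKg //; apply: h1x.
have [_ phiT _] := phiA.
apply/seteqP; split=> [_ [x F1x <-]|y F2y].
  have [y F2y yx] : types F2 (itype x) by rewrite -F12; exists x.
  by rewrite -(on_inj (F2h _ F2y) (phi_on _ F1x)) // phiT.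
have [x F1x xy] : types F1 (itype y) by rewrite F12; exists y.
by exists x => //; apply: on_inj (phi_on _ F1x) (F2h _ F2y) _; rewrite phiT.
Qed.

Lemma coset_geometry_hypertope : regular_hypertope X.
Proof.
split.
- exact: coset_geometry_geometry.
- exact: coset_geometry_thin.
- exact: coset_geometry_residually_connected.
- exact: coset_geometry_flag_transitive.
Qed.

(** The action is faithful because the maximal parabolics meet in 1. *)
Lemma right_mult_uniq phi h h' :
  H h -> H h' -> right_mult h phi -> right_mult h' (phi : X -> X) -> h = h'.
Proof.
have Hgrp := generated_subgroup (range r).
move=> Hh Hh' hphi h'phi; apply: divg1_eq; apply: meet_all.
  by apply: (subgroupM Hgrp) => //; apply: (subgroupV Hgrp).
move=> l; have [x xl x1] := on_ex l (subgroup1 Hgrp).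
have : rcoset (val x).2 h = rcoset (val x).2 h'.
  by have := h'phi x; rewrite hphi => -[].
rewrite (on_val x1) xl /= rcoset1 => /rcoset_eqP; apply.
exact: parabolic_subgroup.
Qed.

(** The image of the chamber 1 is a chamber [h]. An automorphism then sends the
chamber [g] to [g * h]: by thinness this passes from a chamber to the adjacent
ones, and all chambers are reached in this way since [H] is generated by the
[r k]. *)
Lemma automorphism_right_mult (phi : X -> X) :
  automorphism phi -> exists2 h, H h & right_mult h phi.
Proof.
have Hgrp := generated_subgroup (range r).
case=> phi_bij phiT phiI.
have phi_flag C : flag C -> exists2 h, H h & forall x, C x -> on h (phi x).
  move=> Cflag; have [|h Hh Ch] := @flagP (phi @` C).
    by move=> _ _ [x Cx <-] [y Cy <-]; apply/phiI/Cflag.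
  by exists h => // x Cx; apply: Ch; exists x.
have flag_on h : flag [set x | on h x] by move=> x y; apply: on_incident.
have [h Hh h1] := phi_flag _ (flag_on 1).
exists h => //.
suff phiP g : H g -> forall x, on g x -> on (g * h) (phi x).
  move=> x; have [g gx] := on_some x; have /on_val := phiP g (on_H gx) x gx.
  by move=> ->; rewrite phiT (on_val gx) rcosetM.
move=> Hg; suff [] : H g /\ forall x, on g x -> on (g * h) (phi x) by [].
move: Hg; elim/generated_ind => [_ [k _ <-] // ||_ g' [k _ <-] [Hg IH]].
  by split=> [|x x1]; [apply: (subgroup1 Hgrp) | rewrite mul1g; apply: h1].
have Hk := range_gen k; split=> [|x kgx]; first exact: (subgroupM Hgrp).
have gy y : itype y != k -> on (r k * g') y -> on g' y.
  move=> yk kgy; rewrite -(mulKg (r k) g'); apply/(on_mul _ kgy).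
  apply: (subgroupV (@parabolic_subgroup _)); exact: parabolic_gen.
have [xk|xk] := eqVneq (itype x) k; last first.
  rewrite -mulgA; apply/(on_mul _ (IH _ (gy _ xk kgx))).
  by rewrite phiT; apply: parabolic_gen.
have [z Hz kgz] := phi_flag _ (flag_on (r k * g')).
have Hgh : H (g' * h) by apply: (subgroupM Hgrp).
have : z * (g' * h)^-1 = 1 \/ z * (g' * h)^-1 = r k.
  apply: meet_all_but => [|l lk].
    by apply: (subgroupM Hgrp) => //; apply: (subgroupV Hgrp).
  have [y yl kgy] := on_ex l (subgroupM Hgrp Hk Hg).
  have yk : itype y != k by rewrite yl.
  rewrite -yl -phiT; apply/(on_mul _ (IH _ (gy _ yk kgy))); rewrite mulgVK.
  exact: kgz kgy.
have := kgz _ kgx; rewrite -{1}(mulgVK (g' * h) z) => zx [zh|zh]; last first.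
  by rewrite -mulgA -zh.
(* Otherwise [phi] would identify the elements of type [k] of two adjacent
   chambers. *)
rewrite zh mul1g in zx.
have [y yk gy'] := on_ex k Hg.
have xy : x = y.
  apply: (bij_inj phi_bij); apply: on_inj zx (IH _ gy') _.
  by rewrite !phiT xk yk.
by case: (@r_notin k); move: kgx; rewrite xy => /(on_mul _ gy'); rewrite yk.
Qed.

Lemma coset_geometry_automorphisms : automorphism_group_is_right_mult H P.
Proof.
split=> [|phi phiA]; first exact: right_mult_automorphism.
have [h Hh hphi] := automorphism_right_mult phiA; exists h; split=> //.
by move=> h' [Hh' h'phi]; apply: right_mult_uniq hphi h'phi.
Qed.

End CosetGeometry.

(** * C-groups of rank three with a linear diagram *)

(** Both sides of the intersection property are meets of maximal parabolics. *)
Lemma C_group_of_meets (U : groupType) n (r : 'I_n -> U) :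
    (forall i, r i * r i = 1) -> (forall i, ~ parabolic r i (r i)) ->
    (forall (J : set 'I_n) g, generated (range r) g ->
       (forall l, ~ J l -> parabolic r l g) -> generated (r @` J) g) ->
  C_group r.
Proof.
move=> r2 r_notin meetP; split=> [i|J K].
  split=> // ri1; apply: (r_notin i); rewrite ri1.
  exact: (subgroup1 (generated_subgroup _)).
apply/seteqP; split=> g; last first.
  by move=> JKg; split; move: g JKg; apply: generatedS;
    apply: image_subset => ? [].
move=> [Jg Kg]; apply: meetP => [|l /not_andP[] nl].
- by move: Jg; apply: generatedS; apply: image_subset.
- move: Jg; apply: generatedS; apply: image_subset => j Jj /=.
  by apply/eqP => jl; apply: nl; rewrite -jl.
- move: Kg; apply: generatedS; apply: image_subset => j Jj /=.
  by apply/eqP => jl; apply: nl; rewrite -jl.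
Qed.

Lemma C_group_reorder (U : groupType) n (r : 'I_n -> U) (e : 'I_n -> 'I_n) :
  injective e -> C_group r -> C_group (r \o e).
Proof.
move=> e_inj [r2 rI]; split=> [i|J K]; first exact: r2.
have rE L : (r \o e) @` L = r @` (e @` L) by rewrite image_comp.
rewrite !rE rI; congr (generated (r @` _)); apply/seteqP; split=> i.
  by case=> -[j Jj <-] [k Kk /e_inj jk]; exists j => //; split; rewrite // -jk.
by case=> j [Jj Kj] <-; split; exists j.
Qed.

(** The third index is [3 - l - k], because the three of them add up to 3. *)
Lemma ord3_third (l k : 'I_3) : l != k ->
  exists m, forall j, j != m -> j = l \/ j = k.
Proof.
move=> lk; have m3 : (3 - l - k < 3)%N.
  by move: lk; rewrite -val_eqE /=; lia.
exists (Ordinal m3) => j; rewrite -val_eqE /= => jm.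
have [] : j = l :> nat \/ j = k :> nat.
  by move: lk (ltn_ord j) (ltn_ord l) (ltn_ord k); rewrite -val_eqE /=; lia.
  by move/ord_inj; left.
by move/ord_inj; right.
Qed.

Section RankThree.
Variables (U : groupType) (r : 'I_3 -> U).
Local Notation H := (generated (range r)).
Local Notation P := (parabolic r).
Local Notation X := (hypertope_of r).

(** A set [J] of types that is neither full nor of cardinality two misses two
types, and the two corresponding maximal parabolics have besides 1 only the
generator of the third type in common. *)
Lemma rank3_meet : (forall i, ~ P i (r i)) ->
    (forall k g, (forall l, l != k -> P l g) -> g = 1 \/ g = r k) ->
  forall (J : set 'I_3) g, H g -> (forall l, ~ J l -> P l g) ->
    generated (r @` J) g.
Proof.
move=> r_notin meet_all_but J g Hg Pg.
have Jgrp := generated_subgroup (r @` J).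
have [JT|/existsNP[l Jl]] := pselect (forall l, J l).
  by move: Hg; apply: generatedS; apply: image_subset.
have [Jk|/existsNP[k /not_implyP[kl Jk]]] := pselect (forall k, k != l -> J k).
  by have := Pg _ Jl; apply: generatedS; apply: image_subset.
have [m mP] := ord3_third kl.
have [|->|gm] := meet_all_but m g; first by move=> j /mP[]->; apply: Pg.
  exact: (subgroup1 Jgrp).
have [Jm|Jm] := pselect (J m).
  by rewrite gm; apply: sub_generated; exists m.
by case: (@r_notin m); rewrite -gm; apply: Pg.
Qed.

(* The linear diagram is a - b - c. *)
Variables a b c : 'I_3.
Hypotheses (ab : a != b) (bc : b != c) (ac : a != c).
Hypothesis r2 : forall i, r i * r i = 1.
Hypothesis rac : commute (r a) (r c).

Lemma ord3_cases l : [\/ l = a, l = b | l = c].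
Proof.
have [m mP] := ord3_third ab; have [<-|cm] := eqVneq m c; last first.
  have [//|ca|cb] := mP c; first by rewrite eq_sym.
    by move: ac; rewrite ca eqxx.
  by move: bc; rewrite cb eqxx.
have [->|/mP[]->] := eqVneq l m; [exact: Or33 | exact: Or31 | exact: Or32].
Qed.

(** The end generators commute, so [P b] consists of the products of an element
of the group of [r c] by one of the group of [r a]. *)
Lemma parabolic_middle g : P b g ->
  exists v u, [/\ P a v, P b v, P c u, P b u & g = v * u].
Proof.
have Pgrp l := @parabolic_subgroup U 3 r l.
suff ex : P b g -> exists v u,
    [/\ P a v, P b v, P c u, P b u & g = v * u /\ commute (r a) v].
  by case/ex => v [u [av bv cu bu [-> _]]]; exists v, u.
elim/generated_ind => [_ [j _ <-] // ||_ y [j /= jb <-]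
    [v [u [av bv cu bu [-> rav]]]]].
  exists 1, 1; split; try exact: (subgroup1 (Pgrp _)).
  by rewrite mulg1; split=> //; apply: commute1.
case: (ord3_cases j) => jE; last first.
- exists (r c * v), u; split=> //.
  + by apply: (subgroupM (Pgrp _)) => //; apply: parabolic_gen.
  + by apply: (subgroupM (Pgrp _)) => //; apply: parabolic_gen.
  + by rewrite jE mulgA; split=> //; apply: commuteM.
- by rewrite jE eqxx in jb.
- exists v, (r a * u); split=> //.
  + by apply: (subgroupM (Pgrp _)) => //; apply: parabolic_gen; rewrite eq_sym.
  + by apply: (subgroupM (Pgrp _)) => //; apply: parabolic_gen; rewrite eq_sym.
  + by rewrite jE !mulgA rav.
Qed.

(** The middle type decides. An element [y] of type [b] meets the elements of
types [a] and [c] of the flag in [k] and [m]; as [k * m^-1] splits into a factor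
in [P a] and one in [P c], moving the first across gives a point common to all
three. A flag without element of type [b] has at most two elements. *)
Lemma rank3_flag (F : set X) : flag F -> exists2 h, H h & F `<=` on h.
Proof.
have Pgrp l := @parabolic_subgroup U 3 r l.
move=> Fflag; have pair x i : F x ->
    exists2 h, on h x & forall z, F z -> itype z = i -> on h z.
  move=> Fx; have [[y Fy yi]|noy] := pselect (exists2 y, F y & itype y = i).
    have /incidentP[h hx hy] := Fflag _ _ Fx Fy; exists h => // z Fz zi.
    have /incidentP[k ky kz] := Fflag _ _ Fy Fz.
    by have -> : z = y by have := on_inj kz ky; apply; rewrite zi yi.
  have [h hx] := on_some x; exists h => // z Fz zi.
  by case: noy; exists z.
have same h x z : F x -> F z -> on h x -> itype z = itype x -> on h z.
  move=> Fx Fz hx zx; have /incidentP[k kx kz] := Fflag _ _ Fx Fz.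
  by rewrite (on_inj kz kx zx).
have [[y Fy yb]|nob] := pselect (exists2 y, F y & itype y = b).
  have [k ky ka] := pair _ a Fy; have [m my mc] := pair _ c Fy.
  have : P b (k * m^-1).
    by rewrite -yb; apply/(on_mul _ my); rewrite mulgVK.
  case/parabolic_middle => v [u [av bv cu bu km]].
  (* The point [u * m] lies on [y], and on the other two by its two forms. *)
  have um : u * m = v^-1 * k by rewrite -(mulgVK m k) km !mulgA mulVg mul1g.
  have umy : on (u * m) y by apply/(on_mul _ my); rewrite yb.
  exists (u * m); first exact: on_H umy.
  move=> z Fz; case: (ord3_cases (itype z)) => zE.
  - rewrite um; apply/(on_mul _ (ka _ Fz zE)); rewrite zE.
    exact: (subgroupV (Pgrp _)).
  - by apply: same umy _ => //; rewrite yb.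
  - by apply/(on_mul _ (mc _ Fz zE)); rewrite zE.
have [[x Fx xa]|noa] := pselect (exists2 x, F x & itype x = a).
  have [h hx hc] := pair _ c Fx; exists h; first exact: on_H hx.
  move=> z Fz; case: (ord3_cases (itype z)) => zE; last exact: hc.
    by apply: same hx _ => //; rewrite xa.
  by case: nob; exists z.
have [[x Fx]|F0] := pselect (exists x, F x).
  have [h hx] := on_some x; exists h; first exact: on_H hx.
  have xc z : F z -> itype z = c.
    move=> Fz; case: (ord3_cases (itype z)) => // zE.
      by case: noa; exists z.
    by case: nob; exists z.
  by move=> z Fz; apply: same hx _ => //; rewrite !xc.
exists 1; first exact: (subgroup1 (generated_subgroup _)).
by move=> z Fz; case: F0; exists z.
Qed.

End RankThree.

(** * Homomorphisms from Coxeter groups *)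

Section CoxeterLift.
Variables (I : choiceType) (m : I -> I -> nat) (U : groupType) (a : I -> U).
Hypotheses (a2 : forall i, a i * a i = 1)
  (am : forall i j, i <> j -> (a i * a j) ^+ m i j = 1).

Lemma cox_eq_prod v w :
  cox_eq m v w -> \prod_(i <- v) a i = \prod_(i <- w) a i.
Proof.
elim=> {v w} [//|//|u v w _ -> _ -> //|i v w|i j v w ij].
  by rewrite big_cat [in RHS]big_cat /= !big_cons (mulgA (a i)) a2 mul1g.
suff -> k : \prod_(l <- v ++ flatten (nseq k [:: i; j]) ++ w) a l =
    \prod_(l <- v) a l * (a i * a j) ^+ k * \prod_(l <- w) a l.
  by rewrite am // mulg1 big_cat.
elim: k => [|k IHk]; first by rewrite big_cat /= mulg1.
rewrite big_cat /= !big_cons expgS !mulgA; move: IHk; rewrite big_cat /=.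
by rewrite -!mulgA => /mulgI ->.
Qed.

(** The relations are arguments, so that the morphism structure below can be
attached to the function. *)
Definition cox_lift (_ : forall i, a i * a i = 1)
    (_ : forall i j, i <> j -> (a i * a j) ^+ m i j = 1)
    (x : coxeter_group m) : U := \prod_(i <- cox_repr x) a i.
Local Notation lift := (cox_lift a2 am).

Lemma cox_lift_word w : lift (cox_word m w) = \prod_(i <- w) a i.
Proof. exact: cox_eq_prod (cox_repr_word m w). Qed.

Lemma cox_lift_gen i : lift (cox_gen m i) = a i.
Proof. by rewrite cox_lift_word big_seq1. Qed.

Lemma cox_lift_gmulfM : {morph lift : x y / x * y}.
Proof.
move=> x y; rewrite -(cox_reprK x) -(cox_reprK y) -cox_wordM !cox_lift_word.
by rewrite big_cat.
Qed.

Lemma cox_lift1 : lift 1 = 1.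
Proof. by rewrite -[1]/(cox_word m [::]) cox_lift_word big_nil. Qed.

HB.instance Definition _ :=
  isMultiplicative.Build _ _ (cox_lift a2 am) cox_lift_gmulfM.
HB.instance Definition _ :=
  Multiplicative_isUMagmaMorphism.Build _ _ (cox_lift a2 am) cox_lift1.
End CoxeterLift.

(** * Quotient groups *)

Section Quotient.
Local Open Scope quotient_scope.
Variables (U : groupType) (N : set U).
Hypotheses (Ng : subgroup N) (Nnorm : forall x y, N x -> N (x ^ y)).

Definition quotient_rel of subgroup N &
    (forall x y, N x -> N (x ^ y)) : rel U :=
  fun x y => `[< N (x * y^-1) >].
Local Notation qrel := (quotient_rel Ng Nnorm).

Lemma quotient_rel_refl : reflexive qrel.
Proof. by move=> x; apply/asboolP; rewrite mulgV; apply: (subgroup1 Ng). Qed.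

Lemma quotient_rel_sym : symmetric qrel.
Proof.
by move=> x y; apply/asboolP/asboolP => /(subgroupV Ng); rewrite invgF.
Qed.

Lemma quotient_rel_trans : transitive qrel.
Proof.
move=> y x z /asboolP xy /asboolP yz; apply/asboolP.
by rewrite -(divgKA y x z^-1); apply: (subgroupM Ng).
Qed.

Canonical quotient_equiv :=
  EquivRel qrel quotient_rel_refl quotient_rel_sym quotient_rel_trans.

Definition quotient_group : Type := {eq_quot quotient_equiv}.
HB.instance Definition _ := Choice.on quotient_group.

Definition quotient_proj (x : U) : quotient_group :=
  \pi_{eq_quot quotient_equiv} x.
Local Notation pi := quotient_proj.
Definition quotient_repr (x : quotient_group) : U :=
  repr (x : {eq_quot quotient_equiv}).

Lemma quotient_projP x y : pi x = pi y <-> N (x * y^-1).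
Proof.
split=> [/eqquotP/asboolP //|Nxy].
by apply/eqquotP/asboolP.
Qed.

Lemma quotient_reprK x : pi (quotient_repr x) = x.
Proof. exact: (reprK (x : {eq_quot quotient_equiv})). Qed.

Lemma quotient_repr_proj x : N (quotient_repr (pi x) * x^-1).
Proof. by apply/quotient_projP; rewrite quotient_reprK. Qed.

Definition quotient_mul x y := pi (quotient_repr x * quotient_repr y).
Definition quotient_inv x := pi (quotient_repr x)^-1.

(** The discrepancy between the product of the representatives and [x * y] is
the product of an element of [N] by a conjugate of another. *)
Lemma quotient_mulE x y : quotient_mul (pi x) (pi y) = pi (x * y).
Proof.
apply/quotient_projP; set u := quotient_repr _; set v := quotient_repr _.
have -> : u * v * (x * y)^-1 = (u * x^-1) * (v * y^-1) ^ x^-1.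
  by rewrite conjgE invgK invgM !mulgA mulgVK.
by apply: (subgroupM Ng); [|apply: Nnorm]; apply: quotient_repr_proj.
Qed.

Lemma quotient_invE x : quotient_inv (pi x) = pi x^-1.
Proof.
apply/quotient_projP; rewrite invgK; set u := quotient_repr _.
have -> : u^-1 * x = (u * x^-1)^-1 ^ x.
  by rewrite conjgE invgF !mulgA mulVg mul1g.
by apply/Nnorm/(subgroupV Ng)/quotient_repr_proj.
Qed.

Lemma quotient_mulA : associative quotient_mul.
Proof.
move=> x y z.
rewrite -(quotient_reprK x) -(quotient_reprK y) -(quotient_reprK z).
by rewrite !quotient_mulE mulgA.
Qed.

Lemma quotient_mul1 : left_id (pi 1) quotient_mul.
Proof. by move=> x; rewrite -(quotient_reprK x) quotient_mulE mul1g. Qed.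

Lemma quotient_1mul : right_id (pi 1) quotient_mul.
Proof. by move=> x; rewrite -(quotient_reprK x) quotient_mulE mulg1. Qed.

Lemma quotient_mulV : left_inverse (pi 1) quotient_inv quotient_mul.
Proof.
by move=> x; rewrite -(quotient_reprK x) quotient_invE quotient_mulE mulVg.
Qed.

Lemma quotient_Vmul : right_inverse (pi 1) quotient_inv quotient_mul.
Proof.
by move=> x; rewrite -(quotient_reprK x) quotient_invE quotient_mulE mulgV.
Qed.

HB.instance Definition _ := isGroup.Build quotient_group
  quotient_mulA quotient_mul1 quotient_1mul quotient_mulV quotient_Vmul.

Lemma quotient_proj_gmulfM : {morph pi : x y / x * y}.
Proof. by move=> x y; rewrite -quotient_mulE. Qed.

HB.instance Definition _ :=
  isMultiplicative.Build U quotient_group pi quotient_proj_gmulfM.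
HB.instance Definition _ :=
  Multiplicative_isUMagmaMorphism.Build U quotient_group pi erefl.

Lemma quotient_proj_eq1 x : pi x = 1 <-> N x.
Proof. by rewrite -[1]/(pi 1) quotient_projP invg1 mulg1. Qed.

End Quotient.

(** * Dihedral groups *)

Section Dihedral.
Variable n : nat.

(** The pair [(e, k)] stands for [b ^+ e * (a * b) ^+ k], where [a] and [b] are
the generating reflections. *)
Definition dihedral : Type := (bool * 'Z_n)%type.
HB.instance Definition _ := Finite.copy dihedral (bool * 'Z_n)%type.

Definition dih_sgn (e : bool) (k : 'Z_n) : 'Z_n := (if e then - k else k)%R.
Definition dih_one : dihedral := (false, 0%R).
Definition dih_mul (x y : dihedral) : dihedral :=
  (x.1 (+) y.1, (dih_sgn y.1 x.2 + y.2)%R).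
Definition dih_inv (x : dihedral) : dihedral := (x.1, dih_sgn (~~ x.1) x.2).

Lemma dih_mulA : associative dih_mul.
Proof.
move=> [e k] [f l] [g m]; rewrite /dih_mul /= addbA; congr pair.
by case: f g => [] []; rewrite /= GRing.addrA // GRing.opprD ?GRing.opprK.
Qed.

Lemma dih_mul1 : left_id dih_one dih_mul.
Proof.
by move=> [[] k]; rewrite /dih_mul /= ?GRing.oppr0 GRing.add0r.
Qed.

Lemma dih_1mul : right_id dih_one dih_mul.
Proof. by move=> [[] k]; rewrite /dih_mul /= GRing.addr0. Qed.

Lemma dih_mulV : left_inverse dih_one dih_inv dih_mul.
Proof. by move=> [[] k]; rewrite /dih_mul /= GRing.addNr. Qed.

Lemma dih_Vmul : right_inverse dih_one dih_inv dih_mul.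
Proof.
by move=> [[] k]; rewrite /dih_mul /= ?GRing.addNr // GRing.addrN.
Qed.

HB.instance Definition _ := isGroup.Build dihedral
  dih_mulA dih_mul1 dih_1mul dih_mulV dih_Vmul.

Definition dih_b : dihedral := (true, 0%R).
Definition dih_t : dihedral := (false, 1%R).
Definition dih_a : dihedral := (true, (-1)%R).

Lemma dih_bb : dih_b * dih_b = 1.
Proof. by congr pair; rewrite /= GRing.addr0 GRing.oppr0. Qed.

Lemma dih_aa : dih_a * dih_a = 1.
Proof. by congr pair; rewrite /= GRing.opprK GRing.addrN. Qed.

Lemma dih_ab : dih_a * dih_b = dih_t.
Proof. by congr pair; rewrite /= GRing.opprK GRing.addr0. Qed.

Lemma dih_tX k : dih_t ^+ k = (false, k%:R%R).
Proof.
elim: k => [//|k IHk]; rewrite expgS IHk; congr pair => /=.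
by rewrite GRing.mulrS.
Qed.

Lemma card_dihedral : (1 < n)%N -> #|{: dihedral}| = (2 * n)%N.
Proof. by move=> n_gt1; rewrite card_prod card_bool card_ord Zp_cast. Qed.

Hypothesis n_gt1 : (1 < n)%N.

Lemma dih_tX_eq1 k : (dih_t ^+ k == 1) = (n %| k)%N.
Proof.
rewrite dih_tX xpair_eqE /= -val_eqE /= val_Zp_nat //.
Qed.

Lemma dih_b_neq_a : dih_b <> dih_a.
Proof.
by move/(congr1 snd)/esym/eqP; rewrite GRing.oppr_eq0 GRing.oner_eq0.
Qed.

Section Hom.
Variables (U : groupType) (a b : U).
Hypotheses (aa : a * a = 1) (bb : b * b = 1) (abn : (a * b) ^+ n = 1).

Definition dih_map (x : dihedral) : U := b ^+ x.1 * (a * b) ^+ (x.2 : nat).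

Lemma dih_map1 : dih_map 1 = 1.
Proof. by rewrite /dih_map /= mulg1. Qed.

Lemma rot_nat k : (a * b) ^+ (k%:R%R : 'Z_n) = (a * b) ^+ k.
Proof.
rewrite val_Zp_nat // {2}(divn_eq k n) mulnC expgnDr expgnA abn.
by rewrite expg1n mul1g.
Qed.

Lemma rotD (k l : 'Z_n) : (a * b) ^+ (k + l)%R = (a * b) ^+ k * (a * b) ^+ l.
Proof.
by rewrite -expgnDr -[in RHS]rot_nat GRing.natrD !natr_Zp.
Qed.

Lemma rotN (k : 'Z_n) : (a * b) ^+ (- k)%R = (a * b) ^- k.
Proof.
by apply: (mulgI ((a * b) ^+ k)); rewrite -rotD GRing.addrN mulgV.
Qed.

(** Each reflection inverts the rotation. *)
Lemma rot_b k : (a * b) ^+ k * b = b * (a * b) ^- k.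
Proof.
have abV : (a * b) ^ b = (a * b)^-1.
  by rewrite conjgE -mulgA bb mulg1 invgM (mulg1_eq aa).
by rewrite [LHS]conjgC conjXg abV expVgn.
Qed.

Lemma dih_map_mul : {morph dih_map : x y / x * y}.
Proof.
move=> [e k] [f l]; rewrite /dih_map /= rotD.
case: f => /=; last by rewrite addbF expg0 mul1g mulgA.
rewrite expg1 rotN !mulgA -[b ^+ e * _ * b]mulgA rot_b !mulgA.
by congr (_ * _ * _); case: e; rewrite ?expg0 ?expg1 ?bb ?mul1g.
Qed.

End Hom.

End Dihedral.

(** A left factor that commutes with all factors but the [j]th is absorbed by
that one. *)
Lemma prodg_mul_factor (U : monoidType) (I : eqType) (s : seq I) (j : I)
    (x : U) (g : I -> U) :
    uniq s -> (forall i, i != j -> commute x (g i)) ->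
  \prod_(i <- s) (if i == j then x * g i else g i) =
    (if j \in s then x else 1) * \prod_(i <- s) g i.
Proof.
move=> + xg; elim: s => [|i s IHs] /= => [_|/andP[is_ s_uniq]].
  by rewrite !big_nil mulg1.
rewrite !big_cons IHs // inE; case: (eqVneq i j) => [ij|ij] /=.
  by rewrite -ij (negPf is_) mul1g mulgA.
by rewrite !mulgA; congr (_ * _); case: ifP => _; rewrite ?mul1g ?mulg1 // xg.
Qed.

Lemma dih_map_id n (n_gt1 : (1 < n)%N) (x : dihedral n) :
  dih_map (dih_a n) (dih_b n) x = x.
Proof.
case: x => e k; rewrite /dih_map dih_ab dih_tX natr_Zp.
by case: e; congr pair; rewrite /= GRing.add0r.
Qed.

(** * The polygon and its vertices *)

Section Polygon.
Variable p : nat.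
Hypothesis p_ge2 : (2 <= p)%N.
Local Notation G := (polygon_group p).
Local Notation n := (2 * p)%N.
Local Notation a := (polygon_gen p ord0).
Local Notation b := (polygon_gen p ord_max).
Local Notation r := (a * b).
Local Notation V := (vertices (@polygon_gen p)).

Lemma two_p_gt1 : (1 < n)%N. Proof. lia. Qed.

Lemma polygon_a_sq : a * a = 1. Proof. exact: cox_genM. Qed.
Lemma polygon_b_sq : b * b = 1. Proof. exact: cox_genM. Qed.
Lemma polygon_rotX : r ^+ n = 1. Proof. exact: cox_genX. Qed.
Hint Resolve polygon_a_sq polygon_b_sq polygon_rotX two_p_gt1 : core.

Lemma ord2_cases (i : 'I_2) : i = ord0 \/ i = ord_max.
Proof.
case: (unliftP ord0 i) => [j ->|]; last by left.
by right; apply: val_inj; rewrite /= (ord1 j).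
Qed.

Lemma polygon_ind (Q : G -> Prop) :
  Q 1 -> (forall g, Q g -> Q (a * g)) -> (forall g, Q g -> Q (b * g)) ->
  forall g, Q g.
Proof.
move=> Q1 Qa Qb; apply: cox_ind => // i g Qg.
by case: (ord2_cases i) => ->; [apply: Qa | apply: Qb].
Qed.

Definition polygon_dih_gen (i : 'I_2) : dihedral n :=
  if i == ord0 then dih_a n else dih_b n.

Lemma polygon_dih_gen2 i : polygon_dih_gen i * polygon_dih_gen i = 1.
Proof. by rewrite /polygon_dih_gen; case: ifP; rewrite ?dih_aa ?dih_bb. Qed.

Lemma polygon_dih_genX i j : i <> j ->
  (polygon_dih_gen i * polygon_dih_gen j) ^+ string_matrix [:: n] i j = 1.
Proof.
have tn : dih_t n ^+ n = 1 by apply/eqP; rewrite dih_tX_eq1.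
case: (ord2_cases i) (ord2_cases j) => -> [] -> // _;
  rewrite /polygon_dih_gen /=.
  by rewrite dih_ab.
by apply: involutions_swapX; rewrite ?dih_aa ?dih_bb ?dih_ab.
Qed.

(** The concrete dihedral group satisfies the relations of the group of the
polygon, which shows that the rotation [r] does not have a smaller order than
[2 * p]. *)
Definition polygon_dih : UMagmaMorphism.type G (dihedral n) :=
  cox_lift polygon_dih_gen2 polygon_dih_genX.

Lemma polygon_dih_a : polygon_dih a = dih_a n.
Proof. exact: cox_lift_gen. Qed.
Lemma polygon_dih_b : polygon_dih b = dih_b n.
Proof. exact: cox_lift_gen. Qed.

Lemma polygon_dih_r : polygon_dih r = dih_t n.
Proof. by rewrite gmulfM polygon_dih_a polygon_dih_b dih_ab. Qed.

Lemma polygon_dihK : cancel polygon_dih (dih_map a b).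
Proof.
have mapM := dih_map_mul two_p_gt1 polygon_a_sq polygon_b_sq polygon_rotX.
have mapb : dih_map a b (dih_b n) = b by rewrite /dih_map /= expg1 mulg1.
have mapa : dih_map a b (dih_a n) = a.
  rewrite -[dih_a n](mulgK (dih_b n)) dih_ab (mulg1_eq (dih_bb _)) mapM mapb.
  rewrite /dih_map mul1g (rot_nat two_p_gt1 polygon_rotX 1) expg1 -mulgA.
  by rewrite polygon_b_sq mulg1.
elim/polygon_ind => [|g IHg|g IHg]; first by rewrite gmulf1 dih_map1.
  by rewrite gmulfM polygon_dih_a mapM IHg mapa.
by rewrite gmulfM polygon_dih_b mapM IHg mapb.
Qed.

Lemma dih_polygonK : cancel (dih_map a b) polygon_dih.
Proof.
move=> x; rewrite /dih_map gmulfM !gmulfXn polygon_dih_r polygon_dih_b.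
by rewrite -[RHS](dih_map_id two_p_gt1 x) /dih_map dih_ab.
Qed.

Lemma polygon_normal_form g :
  exists e : bool, exists2 k, (k < n)%N & g = b ^+ e * r ^+ k.
Proof.
rewrite -(polygon_dihK g); case: (polygon_dih g) => e k; exists e, k => //.
by have := ltn_ord k; rewrite {2}Zp_cast.
Qed.

Lemma rot_eq1 k : r ^+ k = 1 -> (n %| k)%N.
Proof.
move=> rk; rewrite -dih_tX_eq1 // -polygon_dih_r -gmulfXn rk gmulf1 //.
Qed.

Lemma rot_neq_b k : r ^+ k <> b.
Proof.
move/(congr1 polygon_dih); rewrite gmulfXn polygon_dih_r polygon_dih_b dih_tX.
by case.
Qed.

Lemma stabilizerP g : vertex_stabilizer (@polygon_gen p) g <-> g = 1 \/ g = b.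
Proof.
split.
  elim/generated_ind => [_ [i _ <-]||_ h [i /= i0 <-]].
  - exact: cox_genM.
  - by left.
 
  case: (ord2_cases i) i0 => -> // _ [->|->]; rewrite ?mulg1; first by right.
  by left.
case=> ->; first exact: (subgroup1 (generated_subgroup _)).
by apply: sub_generated; exists ord_max.
Qed.

(** The vertices are numbered by the powers of the rotation that carry the base
vertex to them; the central symmetry adds [p] to the number. *)
Definition vertex (k : nat) : V := vertex_act (base_vertex _) (r ^+ k).
Definition antipode (F : V) : V := vertex_act F (polygon_alpha p).

(** The stabiliser of the base vertex consists of 1 and [b]. *)
Lemma vertex_act_eq g h :
  vertex_act (base_vertex (@polygon_gen p)) g = vertex_act (base_vertex _) h <->
  g = h \/ g = b * h.
Proof.
have sg : subgroup (vertex_stabilizer (@polygon_gen p)).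
  exact: generated_subgroup.
split=> [/(congr1 val)/(rcoset_eqP _ _ sg)/stabilizerP[]gh|gh].
- by left; apply: divg1_eq.
- by right; rewrite -gh mulgVK.
apply: val_inj; apply/(rcoset_eqP _ _ sg)/stabilizerP.
by case: gh => ->; rewrite ?mulgV ?mulgK; [left | right].
Qed.

Lemma vertex_actP (F : V) : exists g, F = vertex_act (base_vertex _) g.
Proof.
case: F => F VF; case: (set_mem VF) => g _ gF.
by exists g; apply: val_inj.
Qed.

Lemma vertexP F : exists2 k, (k < n)%N & F = vertex k.
Proof.
have [g ->] := vertex_actP F; have [e [k kn ->]] := polygon_normal_form g.
exists k => //; apply/vertex_act_eq.
by case: e; rewrite ?expg0 ?expg1 ?mul1g; [right | left].
Qed.

Lemma vertex_mod k l : vertex k = vertex l -> k = l %[mod n].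
Proof.
move/vertex_act_eq => [|].
  move/(congr1 polygon_dih); rewrite !gmulfXn polygon_dih_r !dih_tX.
  by move/(congr1 (fun x : dihedral n => x.2 : nat)); rewrite /= !val_Zp_nat.
(* The rotation by [l * n.-1] cancels the one by [l]. *)
move=> rbr; case: (@rot_neq_b (k + l * n.-1)).
rewrite expgnDr rbr -mulgA -expgnDr -mulnS prednK; last exact: ltnW.
by rewrite mulnC expgnA polygon_rotX expg1n mulg1.
Qed.

Lemma vertex_inj k l : (k < n)%N -> (l < n)%N -> vertex k = vertex l -> k = l.
Proof. by move=> kn ln /vertex_mod; rewrite !modn_small. Qed.

Lemma antipode_vertex k : antipode (vertex k) = vertex (k + p).
Proof. by rewrite /antipode /vertex -vertex_actM -expgnDr. Qed.

Lemma antipodeK : involutive antipode.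
Proof.
move=> F; rewrite /antipode -vertex_actM /polygon_alpha -expgnDr addnn -mul2n.
by rewrite polygon_rotX vertex_act1.
Qed.

Lemma antipode_neq F : antipode F <> F.
Proof.
have [k kn ->] := vertexP F; rewrite antipode_vertex => /vertex_mod /eqP.
rewrite -{2}(addn0 k) eqn_modDl mod0n modn_small; lia.
Qed.

Lemma vertex_pair F : exists i : 'I_p, F = vertex i \/ F = antipode (vertex i).
Proof.
have [k kn ->] := vertexP F; have [kp|pk] := ltnP k p.
  by exists (Ordinal kp); left.
have kp : (k - p < p)%N by lia.
by exists (Ordinal kp); right; rewrite antipode_vertex /= subnK.
Qed.

Lemma vertex_pair_inj (i j : 'I_p) :
  vertex i = vertex j \/ vertex i = antipode (vertex j) -> i = j.
Proof.
have := ltn_ord i; have := ltn_ord j => jp ip.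
case=> [|]; first by move/vertex_inj => ij; apply: val_inj; apply: ij; lia.
by rewrite antipode_vertex => /vertex_inj ij; have := ij _ _; lia.
Qed.

Lemma base_vertex0 : base_vertex _ = vertex 0.
Proof. by rewrite /vertex expg0 vertex_act1. Qed.

End Polygon.

(** * The group W as a product of dihedral groups *)

Section VertexReflections.
Variables p s : nat.
Hypotheses (p_ge2 : (2 <= p)%N) (s_ge2 : (2 <= s)%N).
Local Notation V := (vertices (@polygon_gen p)).
Local Notation W := (twist_W (@polygon_gen p) (polygon_alpha p) s).
Local Notation M := (twist_matrix (polygon_alpha p) s).
Local Notation v := (vertex p).
Local Notation A := (@antipode p).
Definition sigma (F : V) : W := cox_gen M F.

Lemma sigma2 F : sigma F * sigma F = 1.
Proof. exact: cox_genM. Qed.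

Lemma sigma_antipode F : (sigma F * sigma (A F)) ^+ s = 1.
Proof.
have ME : M F (A F) = s.
  by rewrite /twist_matrix -/(A F) eqxx; case: eqP => // /(antipode_neq p_ge2).
by rewrite -[X in _ ^+ X]ME; apply: cox_genX; apply/nesym/(antipode_neq p_ge2).
Qed.

Lemma sigma_commute F E : E <> F -> E <> A F -> commute (sigma F) (sigma E).
Proof.
move=> /eqP EF /eqP EA; apply: commute_involutions; rewrite ?sigma2 //.
have := @cox_genX _ M F E; rewrite /twist_matrix -/(A F) (negPf EF) (negPf EA).
by apply; apply/eqP; rewrite eq_sym.
Qed.

Section Coordinate.
Variable i : 'I_p.

(** The projection of [W] onto the dihedral factor of the antipodal pair of the
vertex [i]: the other reflections, which commute with this factor, become
trivial. *)
Definition coord_gen (F : V) : dihedral s :=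
  if F == v i then dih_a s else if F == A (v i) then dih_b s else 1.

Lemma coord_gen2 F : coord_gen F * coord_gen F = 1.
Proof.
by rewrite /coord_gen; case: ifP => _; [|case: ifP => _];
  rewrite ?dih_aa ?dih_bb ?mulg1.
Qed.

Lemma coord_gen_vertex : coord_gen (v i) = dih_a s.
Proof. by rewrite /coord_gen eqxx. Qed.

Lemma coord_gen_antipode : coord_gen (A (v i)) = dih_b s.
Proof. by rewrite /coord_gen eqxx; case: eqP => // /(antipode_neq p_ge2). Qed.

Lemma coord_gen_out F : F <> v i -> F <> A (v i) -> coord_gen F = 1.
Proof. by rewrite /coord_gen; do 2 case: eqP => //. Qed.

Lemma coord_genX F E : F <> E -> (coord_gen F * coord_gen E) ^+ M F E = 1.
Proof.
have ts : dih_t s ^+ s = 1 by apply/eqP; rewrite dih_tX_eq1.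
have ab_ba : (dih_b s * dih_a s) ^+ s = 1.
  by apply: involutions_swapX; rewrite ?dih_aa ?dih_bb ?dih_ab.
move=> FE; rewrite /twist_matrix -/(A F).
case: eqP => [EF|_]; first by case: FE.
have [FV|Fi] := pselect (F = v i).
  rewrite FV coord_gen_vertex; case: eqP => [->|EA].
    by rewrite coord_gen_antipode dih_ab.
  by rewrite (coord_gen_out _ EA) ?mulg1 ?expg2 ?dih_aa // -FV; apply/nesym.
have [FV|Fa] := pselect (F = A (v i)).
  rewrite FV coord_gen_antipode antipodeK //; case: eqP => [->|Ei].
    by rewrite coord_gen_vertex ab_ba.
  by rewrite (coord_gen_out Ei) ?mulg1 ?expg2 ?dih_bb // -FV; apply/nesym.
rewrite (coord_gen_out Fi Fa) mul1g.
case: eqP => [->|_]; last by rewrite expg2 coord_gen2.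
rewrite coord_gen_out ?expg1n // => AF.
  by apply: Fa; rewrite -AF antipodeK.
by apply/Fi/(can_inj (@antipodeK p)).
Qed.

Definition coord : UMagmaMorphism.type W (dihedral s) :=
  cox_lift coord_gen2 coord_genX.

Lemma coord_sigma F : coord (sigma F) = coord_gen F.
Proof. exact: cox_lift_gen. Qed.
End Coordinate.

Definition pair_map (i : 'I_p) : dihedral s -> W :=
  dih_map (sigma (v i)) (sigma (A (v i))).

Lemma pair_map_mul i : {morph pair_map i : x y / x * y}.
Proof.
by apply: dih_map_mul => //; rewrite ?sigma2 ?sigma_antipode.
Qed.

Lemma pair_map_coord_gen (i : 'I_p) F : F = v i \/ F = A (v i) ->
  pair_map i (coord_gen i F) = sigma F.
Proof.
have mapb : pair_map i (dih_b s) = sigma (A (v i)).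
  by rewrite /pair_map /dih_map /= expg1 mulg1.
case=> ->; last by rewrite coord_gen_antipode.
rewrite coord_gen_vertex -[dih_a s](mulgK (dih_b s)) dih_ab.
rewrite (mulg1_eq (dih_bb _)) pair_map_mul mapb /pair_map /dih_map mul1g.
rewrite (rot_nat s_ge2 (sigma_antipode _) 1) expg1 -mulgA.
by rewrite sigma2 mulg1.
Qed.

Lemma commute_pair_map (i : 'I_p) F x : F <> v i -> F <> A (v i) ->
  commute (sigma F) (pair_map i x).
Proof.
move=> Fi FA; rewrite /pair_map /dih_map.
have ci : commute (sigma F) (sigma (v i)).
  by apply/commute_sym/sigma_commute.
have cA : commute (sigma F) (sigma (A (v i))).
  apply/commute_sym/sigma_commute => //; rewrite antipodeK //.
by apply: commuteM; apply: commuteX => //; apply: commuteM.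
Qed.

Definition coords (x : W) : {ffun 'I_p -> dihedral s} := [ffun i => coord i x].
Definition of_coords (m : {ffun 'I_p -> dihedral s}) : W :=
  \prod_(i < p) pair_map i (m i).

Lemma vertex_pair_out (i j : 'I_p) F : F = v j \/ F = A (v j) -> i != j ->
  F <> v i /\ F <> A (v i).
Proof.
move=> Fj /eqP ij; split=> Fi; apply: ij.
  by apply: (vertex_pair_inj p_ge2); rewrite -Fi.
apply/esym/(vertex_pair_inj p_ge2); case: Fj => FE; [right | left].
  by rewrite -FE.
by apply: (inv_inj (@antipodeK p)); rewrite -FE.
Qed.

(** It suffices that left multiplication by a reflection [sigma F] changes only
the coordinate of the antipodal pair of [F], in the same way on both sides. *)
Lemma coordsK : cancel coords of_coords.
Proof.
apply: cox_ind => [|F x IHx].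
  rewrite /of_coords big1 // => i _; rewrite ffunE gmulf1; exact: dih_map1.
have [j Fj] := vertex_pair p_ge2 F.
rewrite -[RHS]/(sigma F * x) -{2}IHx /of_coords.
have comm i : i != j -> commute (sigma F) (pair_map i (coords x i)).
  by move=> /(vertex_pair_out Fj)[]; apply: commute_pair_map.
have := prodg_mul_factor (index_enum_uniq _) comm; rewrite mem_index_enum => <-.
apply: eq_bigr => i _; rewrite !ffunE gmulfM coord_sigma pair_map_mul.
have [->|/(vertex_pair_out Fj)[Fi FA]] := eqVneq i j.
  by rewrite pair_map_coord_gen.
rewrite coord_gen_out // (_ : pair_map i 1 = 1) ?mul1g //.
exact: dih_map1.
Qed.

Lemma of_coordsK : cancel of_coords coords.
Proof.
move=> m; apply/ffunP => i; rewrite ffunE /of_coords gmulf_prod.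
transitivity (\prod_(k < p) if k == i then m i * 1 else 1).
  apply: eq_bigr => k _; rewrite /pair_map /dih_map.
  rewrite !(gmulfM, gmulfXn) !coord_sigma; case: eqVneq => [->|ki].
    rewrite coord_gen_vertex coord_gen_antipode mulg1.
    by rewrite -[RHS](dih_map_id s_ge2).
  have out F : F = v k \/ F = A (v k) -> coord_gen i F = 1.
    rewrite eq_sym in ki.
    by move=> /vertex_pair_out/(_ ki)[]; apply: coord_gen_out.
  rewrite (out _ (or_introl erefl)) (out _ (or_intror erefl)).
  by rewrite mulg1 !expg1n mulg1.
have := @prodg_mul_factor (dihedral s) _ _ i (m i) (fun=> 1)
  (index_enum_uniq _).
rewrite mem_index_enum big1_eq => ->; first by rewrite mulg1.
by move=> k _; apply: commute1.
Qed.

(** The coordinate of the antipodal pair of [F] sends [sigma F] to one of the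
generating reflections of the dihedral factor, and every other [sigma E] to the
other one or to 1. *)
Lemma sigma_inj : injective sigma.
Proof.
move=> F E FE; have [i Fi] := vertex_pair p_ge2 F.
have : coord_gen i F = coord_gen i E by rewrite -!coord_sigma FE.
have coord_neq1 : coord_gen i F <> 1.
  by case: Fi => ->; rewrite ?coord_gen_vertex ?coord_gen_antipode.
have [Ei|Ei] := pselect (E = v i); last first.
  have [EA|EA] := pselect (E = A (v i)); last by rewrite (coord_gen_out Ei EA).
  case: Fi => ->; rewrite EA // coord_gen_vertex coord_gen_antipode.
  by move/esym/(@dih_b_neq_a s).
case: Fi => ->; rewrite Ei // coord_gen_vertex coord_gen_antipode.
by move/(@dih_b_neq_a s).
Qed.

End VertexReflections.

(** * Semidirect products and the parity of words *)

Section Semidirect.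
Variables (N G : groupType) (a : group_action N G).

Lemma sd_inl_gmulfM : {morph sd_inl a : x y / x * y}.
Proof. by move=> x y; congr pair; rewrite /= ?invg1 ?gact1 ?mulg1. Qed.

Lemma sd_inr_gmulfM : {morph sd_inr a : g h / g * h}.
Proof. by move=> g h; congr pair; rewrite /= ?gact_one ?mulg1. Qed.

HB.instance Definition _ :=
  isMultiplicative.Build N (semidirect a) (sd_inl a) sd_inl_gmulfM.
HB.instance Definition _ :=
  Multiplicative_isUMagmaMorphism.Build N (semidirect a) (sd_inl a) erefl.
HB.instance Definition _ :=
  isMultiplicative.Build G (semidirect a) (sd_inr a) sd_inr_gmulfM.
HB.instance Definition _ :=
  Multiplicative_isUMagmaMorphism.Build G (semidirect a) (sd_inr a) erefl.

Lemma sd_decomp (u : semidirect a) : u = sd_inl a u.1 * sd_inr a u.2.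
Proof. by case: u => x g; congr pair; rewrite /= ?gact_one ?mulg1 ?mul1g. Qed.

Lemma sd_inlJ x g : sd_inl a x ^ sd_inr a g = sd_inl a (a x g).
Proof.
rewrite conjgE -gmulfV; congr pair; rewrite /= ?invgK ?mul1g ?mulVg //.
by rewrite gact_one mulg1.
Qed.

End Semidirect.

Section Parity.
Variables (I : choiceType) (m : I -> I -> nat).

(** Every relator has even length, so any word for [x] gives the same parity. *)
Definition cox_parity (x : coxeter_group m) : bool := odd (size (cox_repr x)).

Lemma cox_parity_word w : cox_parity (cox_word m w) = odd (size w).
Proof.
rewrite /cox_parity; move: (cox_repr_word m w); move: (cox_repr _) => v.
elim=> {v w} [//|//|u v w _ -> _ -> //|i v w|i j v w _].
  by rewrite !size_cat !oddD.
rewrite !size_cat !oddD.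
suff -> : odd (size (flatten (nseq (m i j) [:: i; j]))) = false by [].
by elim: (m i j) => //= k ->.
Qed.

Lemma cox_parityM x y : cox_parity (x * y) = cox_parity x (+) cox_parity y.
Proof.
rewrite -(cox_reprK x) -(cox_reprK y) -cox_wordM !cox_parity_word.
by rewrite size_cat oddD.
Qed.

End Parity.

(** * The halving group as a string C-group *)

Section Halving.
Variables p s : nat.
Hypotheses (p_ge2 : (2 <= p)%N) (s_ge2 : (2 <= s)%N).
Local Notation G := (polygon_group p).
Local Notation T := (two_pow_polygon p s).
Local Notation W := (twist_W (@polygon_gen p) (polygon_alpha p) s).
Local Notation act :=
  (twist_action (@polygon_gen p) (@polygon_alpha_central p) s).
Local Notation a := (polygon_gen p ord0).
Local Notation b := (polygon_gen p ord_max).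
Local Notation v := (vertex p).
Local Notation sg := (@sigma p s).
Local Notation F0 := (base_vertex (@polygon_gen p)).

Definition tau : UMagmaMorphism.type G T := sd_inr act.
Definition sigma_hom : UMagmaMorphism.type W T := sd_inl act.
Local Notation S0 := (sigma_hom (sg F0)).

Definition hgen : 'I_3 -> T := halving_gen (@two_pow_polygon_gen p s).
Local Notation H := (generated (range hgen)).
Local Notation P := (parabolic hgen).
Local Notation i0 := (ord0 : 'I_3).
Local Notation i1 := (inord 1 : 'I_3).
Local Notation i2 := (inord 2 : 'I_3).

Lemma ord3_inordP (i : 'I_3) : [\/ i = i0, i = i1 | i = i2].
Proof.
case: i => [[|[|[|//]]] i3]; [apply: Or31 | apply: Or32 | apply: Or33];
  by apply: val_inj; rewrite //= inordK.
Qed.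

Lemma two_pow_gen0 : @two_pow_polygon_gen p s ord0 = S0.
Proof. by rewrite /two_pow_polygon_gen /two_pow_gen unlift_none. Qed.
Lemma two_pow_gen1 : @two_pow_polygon_gen p s i1 = tau a.
Proof.
rewrite /two_pow_polygon_gen /two_pow_gen; case: unliftP => [j|] /(congr1 val).
  rewrite /= inordK //= => -[j0]; congr (tau (polygon_gen p _)).
  by apply: val_inj.
by rewrite /= inordK.
Qed.
Lemma two_pow_gen2 : @two_pow_polygon_gen p s i2 = tau b.
Proof.
rewrite /two_pow_polygon_gen /two_pow_gen; case: unliftP => [j|] /(congr1 val).
  rewrite /= inordK //= => -[j0]; congr (tau (polygon_gen p _)).
  by apply: val_inj.
by rewrite /= inordK.
Qed.

Lemma hgen0 : hgen i0 = S0 * tau a * S0.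
Proof. by rewrite /hgen /halving_gen eqxx two_pow_gen0 two_pow_gen1. Qed.
Lemma hgen1 : hgen i1 = tau a.
Proof. by rewrite /hgen /halving_gen -val_eqE /= inordK //= two_pow_gen1. Qed.
Lemma hgen2 : hgen i2 = tau b.
Proof. by rewrite /hgen /halving_gen -val_eqE /= inordK //= two_pow_gen2. Qed.

Opaque hgen.

Lemma sigma0_sq : S0 * S0 = 1. Proof. by rewrite -gmulfM sigma2 gmulf1. Qed.
Lemma tau_a_sq : tau a * tau a = 1.
Proof. by rewrite -gmulfM polygon_a_sq gmulf1. Qed.
Lemma tau_b_sq : tau b * tau b = 1.
Proof. by rewrite -gmulfM polygon_b_sq gmulf1. Qed.

Lemma sigma_conj_tau F g :
  sigma_hom (sg F) ^ tau g = sigma_hom (sg (vertex_act F g)).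
Proof.
rewrite [LHS]sd_inlJ; congr (sd_inl act).
exact: (twist_act_gen (@polygon_alpha_central p)).
Qed.

Lemma sigma0_conjM (x y : T) :
  S0 * (x * y) * S0 = S0 * x * S0 * (S0 * y * S0).
Proof. by rewrite !mulgA -(mulgA (S0 * x) S0 S0) sigma0_sq mulg1. Qed.

Lemma sigma0_conjK (x : T) : S0 * (S0 * x * S0) * S0 = x.
Proof. by rewrite !mulgA sigma0_sq mul1g -mulgA sigma0_sq mulg1. Qed.

Lemma base_act_b : vertex_act F0 b = F0.
Proof.
by rewrite -[RHS]vertex_act1; apply/vertex_act_eq; right; rewrite mulg1.
Qed.

(** The base reflection commutes with the stabiliser of the base vertex. *)
Lemma sigma0_conj_b : S0 * tau b * S0 = tau b.
Proof.
rewrite (conjgC S0 (tau b)) sigma_conj_tau base_act_b.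
by rewrite -mulgA sigma0_sq mulg1.
Qed.

Lemma hgen_sq i : hgen i * hgen i = 1.
Proof.
case: (ord3_inordP i) => ->;
  rewrite ?hgen0 ?hgen1 ?hgen2 ?tau_a_sq ?tau_b_sq //.
by rewrite -sigma0_conjM tau_a_sq mulg1 sigma0_sq.
Qed.

(** The W-components of [tau h * S0] and [S0 * tau g] are the reflections in
[vertex_act F0 h^-1] and in [F0]. So conjugation by [S0] moves every element of
G out of G, except those fixing [F0]. *)
Lemma tau_sigma0_conj g h :
  tau h = S0 * tau g * S0 -> h = g /\ (g = 1 \/ g = b).
Proof.
move=> hg; have E : tau h * S0 = S0 * tau g.
  by rewrite hg -mulgA sigma0_sq mulg1.
have /= E1 := congr1 (fun u : T => u.1) E.
have /= E2 := congr1 (fun u : T => u.2) E.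
rewrite mulg1 mul1g in E2; rewrite E2 in E1; split=> //.
have : vertex_act F0 g^-1 = vertex_act F0 1.
  rewrite vertex_act1; apply: (sigma_inj p_ge2 s_ge2).
  rewrite -[LHS](twist_act_gen (@polygon_alpha_central p)).
  rewrite -[LHS]mul1g [LHS]E1 invg1.
  by rewrite (twist_act1 (@polygon_alpha_central p)) mulg1.
move=> /vertex_act_eq; rewrite mulg1 => -[] gE; [left | right]; apply: invg_inj.
  by rewrite gE invg1.
by rewrite gE (mulg1_eq (polygon_b_sq p)).
Qed.

Lemma polygon_a_neq : a <> 1 /\ a <> b.
Proof.
split=> E; have := congr1 (polygon_dih p_ge2) E; rewrite polygon_dih_a.
  by rewrite gmulf1.
by rewrite polygon_dih_b => /esym; apply: dih_b_neq_a.
Qed.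

Lemma polygon_b_neq1 : b <> 1.
Proof.
by move=> E; have := congr1 (polygon_dih p_ge2) E; rewrite polygon_dih_b gmulf1.
Qed.

Lemma tau_neq_hgen0 h : tau h <> hgen i0.
Proof. by rewrite hgen0 => /tau_sigma0_conj[_ []]; case: polygon_a_neq. Qed.

(** Since [b] fixes the base vertex, [a] acts on it as [b * a], the inverse of
the rotation. *)
Lemma base_act_a : vertex_act F0 a = v (2 * p).-1.
Proof.
apply/vertex_act_eq; right; apply: (mulIg (a * b)); rewrite -mulgA -expgSr.
rewrite prednK; last lia.
by rewrite polygon_rotX mulg1 mulgA polygon_a_sq mul1g.
Qed.

(** The product is the product of the reflections in [F0] and in its neighbour
[vertex_act F0 a]; for [p >= 2] the latter is neither [F0] nor its antipode. *)
Lemma hgen01_comm : commute (hgen i0) (hgen i1).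
Proof.
have Sa : commute S0 (S0 ^ tau a).
  rewrite sigma_conj_tau; apply: gmulf_commute; apply: sigma_commute => //;
    rewrite base_act_a base_vertex0 ?antipode_vertex => /vertex_inj; lia.
have E : hgen i0 * hgen i1 = S0 * S0 ^ tau a.
  by rewrite hgen0 hgen1 conjgE (mulg1_eq tau_a_sq) !mulgA.
rewrite /commute E Sa hgen0 hgen1 conjgE (mulg1_eq tau_a_sq) !mulgA //.
Qed.

Lemma parabolic0P u : P i0 u -> exists g, u = tau g.
Proof.
elim/generated_ind => [_ [j _ <-]||_ y [j /= j0 <-] [g ->]].
- exact: hgen_sq.
- by exists 1; rewrite gmulf1.
case: (ord3_inordP j) j0 => -> // _; rewrite ?hgen1 ?hgen2 -gmulfM.
  by exists (a * g).
by exists (b * g).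
Qed.

(** Conjugation by [S0] exchanges the generators 0 and 1 and fixes the generator
2; hence this parabolic is the conjugate of G, the one of index 0. *)
Lemma parabolic1P u : P i1 u -> exists g, u = S0 * tau g * S0.
Proof.
elim/generated_ind => [_ [j _ <-]||_ y [j /= j0 <-] [g ->]].
- exact: hgen_sq.
- by exists 1; rewrite gmulf1 mulg1 sigma0_sq.
case: (ord3_inordP j) j0 => -> j0; [| by rewrite eqxx in j0|].
  by exists (a * g); rewrite hgen0 gmulfM sigma0_conjM.
by exists (b * g); rewrite hgen2 gmulfM sigma0_conjM sigma0_conj_b.
Qed.

Lemma parabolic2P u : P i2 u ->
  [\/ u = 1, u = hgen i0, u = hgen i1 | u = hgen i0 * hgen i1].
Proof.
elim/generated_ind => [_ [j _ <-]||_ y [j /= j2 <-] yP]; first exact: hgen_sq.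
  exact: Or41.
have rrK i x : hgen i * (hgen i * x) = x by rewrite mulgA hgen_sq mul1g.
case: (ord3_inordP j) j2 => -> j2; last by rewrite eqxx in j2.
  by case: yP => ->; [rewrite mulg1; apply: Or42 | rewrite hgen_sq; apply: Or41
    | apply: Or44 | rewrite rrK; apply: Or43].
case: yP => ->; [rewrite mulg1; exact: Or43 | | rewrite hgen_sq; exact: Or41 |].
  by rewrite -hgen01_comm; apply: Or44.
by rewrite hgen01_comm rrK; apply: Or42.
Qed.

Lemma ord3_neq01 : i0 != i1. Proof. by rewrite -val_eqE /= inordK. Qed.
Lemma ord3_neq02 : i0 != i2. Proof. by rewrite -val_eqE /= inordK. Qed.
Lemma ord3_neq12 : i1 != i2. Proof. by rewrite -val_eqE /= !inordK. Qed.

Lemma tau_inj : injective tau. Proof. by move=> g h []. Qed.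

Lemma tau_neq_hgen01 h : tau h <> hgen i0 * hgen i1.
Proof.
move=> hE; apply: (@tau_neq_hgen0 (h * a)).
by rewrite gmulfM -/tau hE -hgen1 -mulgA hgen_sq mulg1.
Qed.

Lemma hgen_notin i : ~ P i (hgen i).
Proof.
case: (ord3_inordP i) => ->.
- by move=> /parabolic0P[g /esym/tau_neq_hgen0].
- move=> /parabolic1P[g]; rewrite hgen1 => E; apply: (@tau_neq_hgen0 g).
  by rewrite hgen0 E sigma0_conjK.
- move=> /parabolic2P[]; rewrite ?hgen1 hgen2.
  + move=> tb; apply: polygon_b_neq1; apply: tau_inj; rewrite tb gmulf1 //.
  + exact: tau_neq_hgen0.
  + by move/tau_inj/esym; case: polygon_a_neq.
  + by rewrite -hgen1; apply: tau_neq_hgen01.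
Qed.

(** The three maximal parabolics are G, its conjugate by [S0], and a four-group;
all coincidences among their elements are excluded by [tau_sigma0_conj]. *)
Lemma hgen_meet1 k g : (forall l, l != k -> P l g) -> g = 1 \/ g = hgen k.
Proof.
case: (ord3_inordP k) => -> Pg.
- have := Pg i1; rewrite eq_sym ord3_neq01 => /(_ isT)/parabolic1P[h gE].
  have := Pg i2; rewrite eq_sym ord3_neq02.
  move=> /(_ isT)/parabolic2P[]; [by left|by right| |].
    rewrite hgen1 gE => E; case: (@tau_neq_hgen0 h).
    by rewrite hgen0 -E sigma0_conjK.
  rewrite gE => E; case: (@tau_neq_hgen0 (a * h)).
  have hE : tau h * S0 = tau a * S0 * tau a.
    by apply: (mulgI S0); rewrite mulgA E hgen0 hgen1 !mulgA.
  apply: (mulIg S0); rewrite gmulfM -mulgA hE hgen0 !mulgA tau_a_sq mul1g.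
  by rewrite -(mulgA _ S0 S0) sigma0_sq mulg1.
- have /parabolic0P[h gE] := Pg i0 ord3_neq01.
  have := Pg i2; rewrite eq_sym ord3_neq12.
  move=> /(_ isT)/parabolic2P[]; [by left| |by right|].
    by rewrite gE => /tau_neq_hgen0.
  by rewrite gE => /tau_neq_hgen01.
- have /parabolic0P[h gE] := Pg i0 ord3_neq02.
  have /parabolic1P[h' gE'] := Pg i1 ord3_neq12.
  move: gE'; rewrite gE hgen2 => /tau_sigma0_conj[-> []->]; last by right.
  by left; rewrite gmulf1.
Qed.

Lemma hgen_meet (J : set 'I_3) g : H g -> (forall l, ~ J l -> P l g) ->
  generated (hgen @` J) g.
Proof. exact: rank3_meet hgen_notin hgen_meet1 J g. Qed.

Lemma hgen_flag (F : set (hypertope_of hgen)) :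
  flag F -> exists2 h, H h & F `<=` on h.
Proof.
have i21 : i2 != i1 by rewrite eq_sym ord3_neq12.
exact: (@rank3_flag _ hgen i0 i2 i1 ord3_neq02 i21 ord3_neq01 hgen_sq
  hgen01_comm).
Qed.

Lemma sigma0_conjX x k : (S0 * x * S0) ^+ k = S0 * x ^+ k * S0.
Proof.
elim: k => [|k IHk]; first by rewrite !expg0 mulg1 sigma0_sq.
by rewrite !expgS IHk sigma0_conjM.
Qed.

Lemma tau_rot_order : has_order (tau (a * b)) (2 * p).
Proof.
split=> [||j /andP[j_gt0 jp]]; first lia.
  by rewrite -gmulfXn polygon_rotX gmulf1.
rewrite -gmulfXn -(gmulf1 (s := tau)) => /tau_inj/(rot_eq1 p_ge2).
by move/(dvdn_leq j_gt0); rewrite leqNgt jp.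
Qed.

Lemma hgen02_order : has_order (hgen i0 * hgen i2) (2 * p).
Proof.
have E : hgen i0 * hgen i2 = S0 * tau (a * b) * S0.
  by rewrite hgen0 hgen2 -{1}sigma0_conj_b gmulfM sigma0_conjM.
have [p0 r2p rj] := tau_rot_order; split=> // [|j jp].
  by rewrite E sigma0_conjX r2p mulg1 sigma0_sq.
rewrite E sigma0_conjX => /(congr1 (fun x => S0 * x * S0)).
by rewrite sigma0_conjK mulg1 sigma0_sq; apply: rj.
Qed.

Lemma has_orderV (U : groupType) (x : U) k : has_order x^-1 k -> has_order x k.
Proof.
case=> k0 xk xj; split=> // [|j jk xj1].
  by apply: invg_inj; rewrite -expVgn xk invg1.
by apply: (xj j) => //; rewrite expVgn xj1 invg1.
Qed.

Lemma hgen21_order : has_order (hgen i2 * hgen i1) (2 * p).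
Proof.
apply: has_orderV; rewrite invgM hgen1 hgen2.
rewrite (mulg1_eq tau_a_sq) (mulg1_eq tau_b_sq).
by rewrite -gmulfM; apply: tau_rot_order.
Qed.

Definition diagram : 'I_3 -> 'I_3 := tnth [tuple inord 0; inord 2; inord 1].

Lemma inord0 : inord 0 = i0. Proof. by apply: val_inj; rewrite /= inordK. Qed.

Lemma diagram0 : diagram i0 = i0.
Proof. by rewrite /diagram (tnth_nth i0) /= inord0. Qed.
Lemma diagram1 : diagram i1 = i2.
Proof. by rewrite /diagram (tnth_nth i0) /= inordK. Qed.
Lemma diagram2 : diagram i2 = i1.
Proof. by rewrite /diagram (tnth_nth i0) /= inordK. Qed.

Lemma diagramK : involutive diagram.
Proof.
by move=> i; case: (ord3_inordP i) => ->;
  rewrite ?(diagram0, diagram1, diagram2).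
Qed.

Lemma halving_regular_polytope :
  regular_polytope hgen diagram [:: 2 * p; 2 * p]%N.
Proof.
split.
- exact: inv_bij diagramK.
- exact: coset_geometry_hypertope hgen_sq hgen_notin hgen_meet hgen_flag.
- split.
    apply: C_group_reorder (inv_inj diagramK) _.
    exact: C_group_of_meets hgen_sq hgen_notin hgen_meet.
  move=> i j; case: (ord3_inordP i) (ord3_inordP j) => -> [] ->;
    rewrite /= ?inordK // => _.
  rewrite diagram0 diagram2 hgen01_comm.
  rewrite expg2 -{1}hgen01_comm -mulgA (mulgA (hgen i1)).
  by rewrite hgen_sq mul1g hgen_sq.
- split=> // i j; case: (ord3_inordP i) (ord3_inordP j) => -> [] ->;
    rewrite /= ?inordK // => _.
    by rewrite diagram0 diagram1; apply: hgen02_order.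
  by rewrite diagram1 diagram2; apply: hgen21_order.
Qed.

Lemma halving_automorphisms :
  automorphism_group_is_right_mult H P.
Proof.
exact: coset_geometry_automorphisms hgen_sq hgen_notin hgen_meet hgen_flag.
Qed.

End Halving.

(** * The order of the halving group *)

Section HalvingOrder.
Variables p s : nat.
Hypotheses (p_ge2 : (2 <= p)%N) (s_ge2 : (2 <= s)%N).
Local Notation T := (two_pow_polygon p s).
Local Notation W := (twist_W (@polygon_gen p) (polygon_alpha p) s).
Local Notation a := (polygon_gen p ord0).
Local Notation b := (polygon_gen p ord_max).
Local Notation F0 := (base_vertex (@polygon_gen p)).
Local Notation tau := (tau p s).
Local Notation sigma_hom := (sigma_hom p s).
Local Notation S0 := (sigma_hom (sigma s F0)).
Local Notation hgen := (@hgen p s).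
Local Notation H := (generated (range hgen)).

Definition parity (u : T) : bool := cox_parity (u.1 : W).

Lemma twist_act_parity (x : W) g : cox_parity (twist_act x g) = cox_parity x.
Proof.
rewrite -(cox_reprK x) (twist_actE (@polygon_alpha_central p)) !cox_parity_word.
by rewrite size_map.
Qed.

Lemma parityM (u u' : T) : parity (u * u') = parity u (+) parity u'.
Proof. by rewrite /parity [in LHS]/= cox_parityM twist_act_parity. Qed.

Lemma parity_tau g : parity (tau g) = false.
Proof. exact: (cox_parity_word _ [::]). Qed.

Lemma parity_sigma0 : parity S0.
Proof. by rewrite /parity /= (cox_parity_word _ [:: F0]). Qed.

Lemma halving_gen_mem i : H (hgen i).
Proof. by apply: sub_generated; exists i. Qed.

Lemma halving_tau g : H (tau g).
Proof.
have Hgrp := generated_subgroup (range hgen).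
elim/polygon_ind: g => [|g Hg|g Hg].
- by rewrite gmulf1; apply: (subgroup1 Hgrp).
- rewrite gmulfM -(hgen1 p s).
  by apply: (subgroupM Hgrp) => //; apply: halving_gen_mem.
- rewrite gmulfM -(hgen2 p s).
  by apply: (subgroupM Hgrp) => //; apply: halving_gen_mem.
Qed.

(** [S0] permutes the three generators of the halving group. *)
Lemma halving_sigma0_conj u : H u -> H (S0 * u * S0).
Proof.
have Hgrp := generated_subgroup (range hgen).
elim/generated_ind => [_ [i _ <-]||_ y [i _ <-] Hy]; first exact: hgen_sq.
  by rewrite mulg1 sigma0_sq; apply: (subgroup1 Hgrp).
rewrite sigma0_conjM; apply: (subgroupM Hgrp) => //.
case: (ord3_inordP i) => ->.
- by rewrite hgen0 sigma0_conjK -hgen1; apply: halving_gen_mem.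
- by rewrite hgen1 -hgen0; apply: halving_gen_mem.
- by rewrite hgen2 sigma0_conj_b; apply: halving_tau.
Qed.

(** The union of [H] and its coset by [S0] is stable under left multiplication
by the generators of the whole group, since [S0] normalises [H]. *)
Lemma halving_cover u : H u \/ H (u * S0).
Proof.
have Hgrp := generated_subgroup (range hgen).
pose Q u := H u \/ H (u * S0).
have QS y : Q y -> Q (S0 * y).
  case=> /halving_sigma0_conj Hy; [by right | left].
  by rewrite -mulgA -(mulgA y) sigma0_sq mulg1 in Hy.
have Qt g y : Q y -> Q (tau g * y).
  have Hg := halving_tau g.
  by case=> Hy; [left | right; rewrite -mulgA]; apply: (subgroupM Hgrp).
have Qsigma F y : Q y -> Q (sigma_hom (sigma s F) * y).
  have [g ->] := vertex_actP F.
  rewrite -sigma_conj_tau conjgE -gmulfV -!mulgA => Qy.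
  by apply/Qt/QS/Qt.
suff QW (x : W) g : Q (sigma_hom x * tau g) by rewrite (sd_decomp u); apply: QW.
move: x; apply: cox_ind => [|F x Qx].
  rewrite gmulf1 mul1g -[tau g]mulg1; apply: Qt.
  by left; apply: (subgroup1 Hgrp).
by rewrite gmulfM -mulgA; apply: Qsigma.
Qed.

(** The three generators contain an even number of reflections of [W], whereas
[S0] is odd; as [H] has index at most two, it is the group of even elements. *)
Lemma halving_parity u : H u <-> parity u = false.
Proof.
have Heven y : H y -> parity y = false.
  elim/generated_ind => [_ [i _ <-]||_ z [i _ <-] Hz]; first exact: hgen_sq.
    exact: (cox_parity_word _ [::]).
  rewrite parityM Hz; case: (ord3_inordP i) => ->;
    rewrite ?hgen0 ?hgen1 ?hgen2 ?parity_tau //.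
  by rewrite !parityM parity_sigma0 parity_tau.
split=> [/Heven //|u0]; have [//|/Heven] := halving_cover u.
by rewrite parityM u0 parity_sigma0.
Qed.

(** The bijection of the underlying set of the semidirect product with a finite
type, by which its elements are counted. *)
Definition code (u : T) : {ffun 'I_p -> dihedral s} * dihedral (2 * p) :=
  (coords p_ge2 s_ge2 u.1, polygon_dih p_ge2 u.2).
Definition decode (x : {ffun 'I_p -> dihedral s} * dihedral (2 * p)) : T :=
  (of_coords x.1, dih_map a b x.2).

Lemma codeK : cancel code decode.
Proof.
by case=> x g; rewrite /code /decode /= coordsK // polygon_dihK.
Qed.

Lemma decodeK : cancel decode code.
Proof.
by case=> x g; rewrite /code /decode /= of_coordsK // dih_polygonK.
Qed.

Definition even_codes := [set x | ~~ parity (decode x)]%SET.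

(** Right multiplication by [S0] exchanges even and odd elements. *)
Lemma card_even_codes : #|even_codes| = ((2 * s) ^ p * (2 * p))%N.
Proof.
pose swap x := code (decode x * S0).
have swapK : involutive swap.
  by move=> x; rewrite /swap codeK -mulgA sigma0_sq mulg1 decodeK.
have swapE : (swap @: even_codes = ~: even_codes)%SET.
  apply/setP => x; rewrite -[x]swapK (mem_imset _ _ (inv_inj swapK)) !inE.
  by rewrite {2}/swap codeK parityM parity_sigma0 addbT negbK.
have := cardsC even_codes; rewrite -swapE (card_imset _ (inv_inj swapK)).
rewrite card_prod card_ffun !card_dihedral // ?card_ord; lia.
Qed.

Lemma card_halving : H #= `I_((2 * s) ^ p * (2 * p))%N.
Proof.
rewrite -card_even_codes; pose f u := index (code u) (enum even_codes).
have mem_code u : H u -> code u \in even_codes.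
  by move/halving_parity; rewrite inE codeK => ->.
have fE : f @` H = `I_#|even_codes|.
  apply/seteqP; split=> [_ [u Hu <-]|k /= kE].
    by rewrite /= cardE index_mem mem_enum mem_code.
  have x0 : {ffun 'I_p -> dihedral s} * dihedral (2 * p) by exact: code 1.
  have xE : nth x0 (enum even_codes) k \in even_codes.
    by rewrite -mem_enum mem_nth -?cardE.
  exists (decode (nth x0 (enum even_codes) k)).
    by apply/halving_parity/negbTE; rewrite inE in xE.
  by rewrite /f decodeK index_uniq -?cardE ?enum_uniq.
rewrite -fE card_eq_sym; apply: inj_card_eq => u u' /set_mem Hu /set_mem Hu' ff.
apply: (can_inj codeK).
rewrite -(nth_index (code u) (s := enum even_codes) (x := code u)).
  by rewrite -/(f u) ff /f nth_index // mem_enum mem_code.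
by rewrite mem_enum mem_code.
Qed.

End HalvingOrder.

(** * Normal closures *)

Section NormalClosure.
Variables (U : groupType) (S : set U).

Lemma sub_normal_closure : S `<=` normal_closure S.
Proof. by move=> x Sx K [_]; apply. Qed.

Lemma normal_closure_subgroup : subgroup (normal_closure S).
Proof.
split=> [K [[[K1 _ _] _] _] // |x y Sx Sy K KS|x Sx K KS].
  by case: (KS) => -[[_ KM _] _] _; apply: KM; [apply: Sx | apply: Sy].
by case: (KS) => -[[_ _ KV] _] _; apply: KV; apply: Sx.
Qed.

Lemma normal_closureJ x y : normal_closure S x -> normal_closure S (x ^ y).
Proof. by move=> Sx K KS; case: (KS) => -[_ KJ] _; apply: KJ; apply: Sx. Qed.

Lemma normal_closure_sub (K : set U) : subgroup K ->
  (forall x y, K x -> K (x ^ y)) -> S `<=` K -> normal_closure S `<=` K.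
Proof. by move=> Kg KJ SK; apply: smallest_sub. Qed.
End NormalClosure.
Opaque normal_closure.

Lemma preimage_subgroup (U V : groupType) (f : UMagmaMorphism.type U V)
  (K : set V) : subgroup K -> subgroup (f @^-1` K).
Proof.
case=> K1 KM KV; split=> [|x y Kx Ky|x Kx]; rewrite /preimage /=.
- by rewrite gmulf1.
- by rewrite gmulfM; apply: KM.
- by rewrite gmulfV; apply: KV.
Qed.

Lemma preimage_normal (U V : groupType) (f : UMagmaMorphism.type U V)
    (K : set V) : (forall x y, K x -> K (x ^ y)) ->
  forall x y, (f @^-1` K) x -> (f @^-1` K) (x ^ y).
Proof. by move=> KJ x y Kx; rewrite /preimage /= gmulfJ; apply: KJ. Qed.

Lemma subgroup_unit (U : groupType) : subgroup [set (1 : U)].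
Proof. by split=> [|_ _ -> ->|_ ->] //=; rewrite ?mulg1 ?invg1. Qed.

Lemma normal_unit (U : groupType) (x y : U) :
  [set (1 : U)] x -> [set (1 : U)] (x ^ y).
Proof. by move=> ->; rewrite /= conj1g. Qed.

(** * The relators *)

Section Relators.
Variables (U : groupType).

Definition relator (x0 x1 x2 : U) (j : nat) : U :=
  (x0 * x2) ^+ j.-1 * x0 * x1 * (x2 * x1) ^+ j.-1.

(** Conjugated by [x2], a relator becomes a product of two powers, which is the
form in which it is interpreted as a product of two reflections. *)
Lemma relatorJ x0 x1 x2 j : x2 * x2 = 1 -> (0 < j)%N ->
  relator x0 x1 x2 j ^ x2 = (x2 * x0) ^+ j * (x1 * x2) ^+ j.
Proof.
move=> x22; case: j => // j _; rewrite conjgE (mulg1_eq x22) /relator /=.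
by rewrite !expg_swap !mulgA.
Qed.

Lemma relatorV x0 x1 x2 j : x0 * x0 = 1 -> x1 * x1 = 1 -> x2 * x2 = 1 ->
  (relator x0 x1 x2 j)^-1 = relator x1 x0 x2 j.
Proof.
move=> x00 x11 x22; rewrite /relator !invgM -!expVgn !invgM.
by rewrite (mulg1_eq x00) (mulg1_eq x11) (mulg1_eq x22) !mulgA.
Qed.

End Relators.

Lemma relator_morph (U V : groupType) (f : UMagmaMorphism.type U V) x0 x1 x2 j :
  f (relator x0 x1 x2 j) = relator (f x0) (f x1) (f x2) j.
Proof. by rewrite /relator !(gmulfM, gmulfXn). Qed.

(** The group of order two that acts on the Coxeter group [2p,2p] by the
reversal of the diagram, with [true] as the reversal. *)
Definition flip : Type := bool.
HB.instance Definition _ := Choice.on flip.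
Lemma flip_mulV : left_inverse (false : flip) id addb.
Proof. exact: addbb. Qed.
HB.instance Definition _ :=
  isGroup.Build flip addbA addFb addbF flip_mulV flip_mulV.

(** * The presentation *)

Section Presentation.
Variables p s : nat.
Hypotheses (p_ge2 : (2 <= p)%N) (s_ge2 : (2 <= s)%N).
Local Notation G := (polygon_group p).
Local Notation T := (two_pow_polygon p s).
Local Notation W := (twist_W (@polygon_gen p) (polygon_alpha p) s).
Local Notation M := (twist_matrix (polygon_alpha p) s).
Local Notation a := (polygon_gen p ord0).
Local Notation b := (polygon_gen p ord_max).
Local Notation r := (a * b).
Local Notation F0 := (base_vertex (@polygon_gen p)).
Local Notation tau := (tau p s).
Local Notation sigma_hom := (sigma_hom p s).
Local Notation S0 := (sigma_hom (sigma s F0)).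
Local Notation hgen := (@hgen p s).
Local Notation H := (generated (range hgen)).
Local Notation i0 := (ord0 : 'I_3).
Local Notation i1 := (inord 1 : 'I_3).
Local Notation i2 := (inord 2 : 'I_3).
Local Notation q := [:: 2 * p; 2 * p]%N.
Local Notation C := (string_coxeter 3 q).
Local Notation c := (@string_gen 3 q).
Local Notation V := (vertices (@polygon_gen p)).

Lemma string_gen_sq i : c i * c i = 1. Proof. exact: cox_genM. Qed.

Lemma string_matrix01 : string_matrix q i0 i1 = (2 * p)%N.
Proof. by rewrite /string_matrix -val_eqE /= inordK. Qed.
Lemma string_matrix10 : string_matrix q i1 i0 = (2 * p)%N.
Proof. by rewrite /string_matrix -val_eqE /= inordK. Qed.
Lemma string_matrix12 : string_matrix q i1 i2 = (2 * p)%N.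
Proof. by rewrite /string_matrix -val_eqE /= !inordK. Qed.
Lemma string_matrix21 : string_matrix q i2 i1 = (2 * p)%N.
Proof. by rewrite /string_matrix -val_eqE /= !inordK. Qed.
Lemma string_matrix02 : string_matrix q i0 i2 = 2.
Proof. by rewrite /string_matrix -val_eqE /= inordK. Qed.
Lemma string_matrix20 : string_matrix q i2 i0 = 2.
Proof. by rewrite /string_matrix -val_eqE /= inordK. Qed.

(** For involutions the relation between [x i] and [x j] implies the one between
[x j] and [x i]. *)
Lemma string_relations (U : groupType) (x : 'I_3 -> U) :
    (forall i, x i * x i = 1) ->
    (x i0 * x i1) ^+ (2 * p) = 1 -> (x i1 * x i2) ^+ (2 * p) = 1 ->
    (x i0 * x i2) ^+ 2 = 1 ->
  forall i j, i <> j -> (x i * x j) ^+ string_matrix q i j = 1.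
Proof.
move=> xx x01 x12 x02 i j.
case: (ord3_inordP i) (ord3_inordP j) => -> [] -> // _.
- by rewrite string_matrix01.
- by rewrite string_matrix02.
- by rewrite string_matrix10; apply: involutions_swapX.
- by rewrite string_matrix12.
- by rewrite string_matrix20; apply: involutions_swapX.
- by rewrite string_matrix21; apply: involutions_swapX.
Qed.

Lemma string_rel01 : (c i0 * c i1) ^+ (2 * p) = 1.
Proof.
rewrite -[X in _ ^+ X]string_matrix01; apply: cox_genX; apply/eqP.
exact: ord3_neq01.
Qed.
Lemma string_rel12 : (c i1 * c i2) ^+ (2 * p) = 1.
Proof.
rewrite -[X in _ ^+ X]string_matrix12; apply: cox_genX; apply/eqP.
exact: ord3_neq12.
Qed.
Lemma string_rel02 : (c i0 * c i2) ^+ 2 = 1.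
Proof.
rewrite -[X in _ ^+ X]string_matrix02; apply: cox_genX; apply/eqP.
exact: ord3_neq02.
Qed.

Definition halving_morph_gen i := hgen (diagram i).
Lemma halving_morph_gen2 i : halving_morph_gen i * halving_morph_gen i = 1.
Proof. exact: hgen_sq. Qed.
Lemma halving_morph_genX i j : i <> j ->
  (halving_morph_gen i * halving_morph_gen j) ^+ string_matrix q i j = 1.
Proof.
apply: string_relations; first exact: halving_morph_gen2.
- rewrite /halving_morph_gen diagram0 diagram1.
  by case: (hgen02_order p_ge2 s_ge2).
- rewrite /halving_morph_gen diagram1 diagram2.
  by case: (hgen21_order p_ge2 s_ge2).
- rewrite /halving_morph_gen diagram0 diagram2.
  rewrite (expgMn _ (hgen01_comm p_ge2 s_ge2)).
  by rewrite !expg2 !hgen_sq mulg1.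
Qed.

Definition halving_morph : UMagmaMorphism.type C T :=
  cox_lift halving_morph_gen2 halving_morph_genX.

Lemma halving_morph_c i : halving_morph (c i) = hgen (diagram i).
Proof. exact: cox_lift_gen. Qed.

Lemma range_halving_morph : range halving_morph = H.
Proof.
have Hgrp := generated_subgroup (range hgen).
apply/seteqP; split=> [_ [x _ <-]|].
  move: x; apply: cox_ind => [|i x Hx].
    by rewrite gmulf1; apply: (subgroup1 Hgrp).
  rewrite gmulfM halving_morph_c; apply: (subgroupM Hgrp) => //.
  exact: halving_gen_mem.
apply: generated_sub => [|_ [i _ <-]]; last first.
  by exists (c (diagram i)); rewrite // halving_morph_c diagramK.
split=> [|_ _ [x _ <-] [y _ <-]|_ [x _ <-]].
- by exists 1; rewrite ?gmulf1.
- by exists (x * y); rewrite ?gmulfM.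
- by exists x^-1; rewrite ?gmulfV.
Qed.

Local Notation w := (relator (c i0) (c i2) (c i1)).

Definition halving_relators : set C :=
  [set w j ^+ 2 | j in [set j | (2 <= j <= p.-1)%N]] `|` [set w p ^+ s].
Local Notation N := (normal_closure halving_relators).

(** Up to conjugation the relators are the products of the reflections in the
base vertex and in the vertex [j]. *)
Lemma relator_two_pow j : (0 < j)%N ->
  halving_morph (w j) ^ tau b = sigma_hom (sigma s F0 * sigma s (vertex p j)).
Proof.
move=> j_gt0; rewrite relator_morph !halving_morph_c diagram0 diagram1 diagram2.
rewrite hgen2 relatorJ ?tau_b_sq // hgen1 hgen0 -{1}(sigma0_conj_b p s).
rewrite -sigma0_conjM -gmulfM sigma0_conjX.
have -> : tau (b * a) ^+ j = (tau (r ^+ j))^-1.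
  rewrite -gmulfXn -gmulfV -expVgn invgM.
  by rewrite (mulg1_eq (polygon_a_sq p)) (mulg1_eq (polygon_b_sq p)).
rewrite -[tau a * tau b]gmulfM -gmulfXn -!mulgA -conjgE.
by rewrite sigma_conj_tau gmulfM.
Qed.

Lemma halving_morph_relators x : N x -> halving_morph x = 1.
Proof.
have wX j k : (0 < j)%N ->
    (sigma s F0 * sigma s (vertex p j)) ^+ k = 1 ->
    halving_morph (w j ^+ k) = 1.
  move=> j_gt0 sk; apply: (conjg_inj (tau b)); rewrite gmulfXn conjXg.
  by rewrite relator_two_pow // -gmulfXn sk gmulf1 conj1g.
apply: (normal_closure_sub (K := halving_morph @^-1` [set 1])).
- exact: preimage_subgroup (@subgroup_unit T).
- exact: preimage_normal (@normal_unit T).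
- move=> _ [[j /= /andP[j2 jp] <-]|->]; apply: wX; try lia.
    rewrite expgMn ?expg2 ?sigma2 ?mulg1 //; apply: sigma_commute => //;
      rewrite base_vertex0 ?antipode_vertex => /(vertex_inj p_ge2); lia.
  have -> : vertex p p = antipode F0 by rewrite base_vertex0 antipode_vertex.
  exact: sigma_antipode.
Qed.

Definition rev_gen (i : 'I_3) : C := c (rev_ord i).

Lemma rev_i0 : rev_ord i0 = i2.
Proof. by apply: val_inj; rewrite /= inordK. Qed.
Lemma rev_i1 : rev_ord i1 = i1.
Proof. by apply: val_inj; rewrite /= inordK. Qed.
Lemma rev_i2 : rev_ord i2 = i0.
Proof. by apply: val_inj; rewrite /= inordK. Qed.

Lemma rev_gen_sq i : rev_gen i * rev_gen i = 1.
Proof. exact: string_gen_sq. Qed.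
Lemma rev_genX i j : i <> j ->
  (rev_gen i * rev_gen j) ^+ string_matrix q i j = 1.
Proof.
apply: string_relations rev_gen_sq _ _ _ i j;
  rewrite /rev_gen ?rev_i0 ?rev_i1 ?rev_i2.
- by apply: involutions_swapX string_rel12; apply: string_gen_sq.
- by apply: involutions_swapX string_rel01; apply: string_gen_sq.
- by apply: involutions_swapX string_rel02; apply: string_gen_sq.
Qed.

(** The automorphism of [2p,2p] that exchanges the two ends of the diagram; on
the halving group it becomes the conjugation by [S0]. *)
Definition reversal : UMagmaMorphism.type C C := cox_lift rev_gen_sq rev_genX.

Lemma reversal_c i : reversal (c i) = c (rev_ord i).
Proof. exact: cox_lift_gen. Qed.

Lemma reversalK : involutive reversal.
Proof.
apply: cox_ind => [|i x IHx]; first by rewrite !gmulf1.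
by rewrite !gmulfM !reversal_c rev_ordK IHx.
Qed.

Definition reversal_act (x : C) (e : flip) : C := if e then reversal x else x.

Lemma reversal_actM x y e :
  reversal_act (x * y) e = reversal_act x e * reversal_act y e.
Proof. by case: e => //=; rewrite gmulfM. Qed.
Lemma reversal_act1 x : reversal_act x 1 = x. Proof. by []. Qed.
Lemma reversal_actA x e e' :
  reversal_act x (e * e') = reversal_act (reversal_act x e) e'.
Proof. by case: e e' => [] []; rewrite /= ?reversalK. Qed.

Definition reversal_action : group_action C flip :=
  GroupAction reversal_actM reversal_act1 reversal_actA.

Local Notation L := (semidirect reversal_action).
Definition inC : UMagmaMorphism.type C L := sd_inl reversal_action.
(** The element that is to play the role of the base reflection [S0]. *)
Definition rev_elt : L := sd_inr reversal_action true.

Lemma rev_elt2 : rev_elt * rev_elt = 1.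
Proof.
by rewrite /rev_elt -gmulfM -[RHS](gmulf1 (s := sd_inr reversal_action)).
Qed.

Lemma inC_rev x : inC x ^ rev_elt = inC (reversal x).
Proof. exact: sd_inlJ. Qed.

(** The reversal of the diagram inverts each word [w j]. *)
Lemma relators_reversal x : N x -> N (reversal x).
Proof.
have Ng := normal_closure_subgroup halving_relators.
have rw j : reversal (w j) = (w j)^-1.
  rewrite relatorV ?string_gen_sq // relator_morph !reversal_c.
  by rewrite rev_i0 rev_i1 rev_i2.
apply: (normal_closure_sub (K := reversal @^-1` N)).
- exact: preimage_subgroup Ng.
- exact: preimage_normal (@normal_closureJ _ _).
- move=> x' Rx' /=; have : exists j k, x' = w j ^+ k.
    by case: Rx' => [[j _ <-]|->]; [exists j, 2 | exists p, s].
  case=> j [k xE]; rewrite xE gmulfXn rw expVgn -xE.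
  by apply: (subgroupV Ng); apply: sub_normal_closure.
Qed.

(** The normal closure of the relators in the extension of [C] by the reversal;
it is no larger than in [C]. *)
Definition ext_relators : set L := [set u | u.2 = false /\ N u.1].

Lemma ext_relatorsE u : ext_relators u <-> exists2 x, N x & u = inC x.
Proof.
by split=> [|[x Nx ->]] //; case: u => x e [/= -> Nx]; exists x.
Qed.

Lemma ext_relators_subgroup : subgroup ext_relators.
Proof.
have Ng := normal_closure_subgroup halving_relators.
split=> [|x y /ext_relatorsE[x' Nx ->] /ext_relatorsE[y' Ny ->]
  |x /ext_relatorsE[x' Nx ->]].
- by split=> //; apply: (subgroup1 Ng).
- apply/ext_relatorsE; exists (x' * y'); rewrite ?gmulfM //.
  exact: (subgroupM Ng).
- apply/ext_relatorsE; exists x'^-1; rewrite ?gmulfV //.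
  exact: (subgroupV Ng).
Qed.

Lemma ext_relatorsJ x y : ext_relators x -> ext_relators (x ^ y).
Proof.
move=> /ext_relatorsE[x' Nx ->]; apply/ext_relatorsE.
rewrite (sd_decomp y) conjgM -[sd_inl _ _]/(inC y.1) -gmulfJ sd_inlJ.
exists (reversal_act (x' ^ y.1) y.2) => //.
have Nxy : N (x' ^ y.1) by apply: normal_closureJ.
by case: (y.2) => //=; apply: relators_reversal.
Qed.

Definition ext_quotient : groupType :=
  quotient_group ext_relators_subgroup ext_relatorsJ.
Definition ext_proj : UMagmaMorphism.type L ext_quotient :=
  quotient_proj ext_relators_subgroup ext_relatorsJ.

Local Notation x i := (ext_proj (inC (c i))).
Local Notation t := (ext_proj rev_elt).

Lemma proj_inC_eq1 y : ext_proj (inC y) = 1 <-> N y.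
Proof. by split=> [/quotient_proj_eq1[]|Ny] //; apply/quotient_proj_eq1. Qed.

Lemma proj_rev_sq : t * t = 1. Proof. by rewrite -gmulfM rev_elt2 gmulf1. Qed.
Lemma proj_gen_sq i : x i * x i = 1.
Proof. by rewrite -!gmulfM string_gen_sq !gmulf1. Qed.
Lemma proj_gen_rev i : x i ^ t = x (rev_ord i).
Proof. by rewrite -gmulfJ inC_rev reversal_c. Qed.

Definition polygon_morph_gen (i : 'I_2) : ext_quotient :=
  if i == ord0 then x i2 else x i1.
Lemma polygon_morph_gen2 i : polygon_morph_gen i * polygon_morph_gen i = 1.
Proof. by rewrite /polygon_morph_gen; case: ifP => _; apply: proj_gen_sq. Qed.
Lemma polygon_morph_genX i j : i <> j ->
  (polygon_morph_gen i * polygon_morph_gen j)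
    ^+ string_matrix [:: 2 * p]%N i j = 1.
Proof.
have x12 : (x i1 * x i2) ^+ (2 * p) = 1.
  by rewrite -!gmulfM -!gmulfXn string_rel12 !gmulf1.
case: (ord2_cases i) (ord2_cases j) => -> [] -> // _;
  rewrite /polygon_morph_gen /= //.
by apply: involutions_swapX => //; apply: proj_gen_sq.
Qed.

Definition polygon_morph : UMagmaMorphism.type G ext_quotient :=
  cox_lift polygon_morph_gen2 polygon_morph_genX.
Lemma polygon_morph_a : polygon_morph a = x i2. Proof. exact: cox_lift_gen. Qed.
Lemma polygon_morph_b : polygon_morph b = x i1. Proof. exact: cox_lift_gen. Qed.

Definition vertex_rep (F : V) : G := projT1 (cid (vertex_actP F)).
Lemma vertex_repP F : F = vertex_act F0 (vertex_rep F).
Proof. exact: projT2 (cid (vertex_actP F)). Qed.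

(** The image planned for the reflection in the vertex [F]: the conjugate of [t]
by the image of an element of G carrying the base vertex to [F]. *)
Definition reflection_image (F : V) : ext_quotient :=
  t ^ polygon_morph (vertex_rep F).

Lemma proj_rev_b : t ^ x i1 = t.
Proof.
apply/conjg_fixP; rewrite commg1_sym; apply/conjg_fixP.
by rewrite proj_gen_rev rev_i1.
Qed.

(** Two elements carrying the base vertex to the same vertex differ by the
stabiliser, and [t] commutes with the image of the stabiliser. *)
Lemma reflection_image_base g :
  reflection_image (vertex_act F0 g) = t ^ polygon_morph g.
Proof.
rewrite /reflection_image; set h := vertex_rep _.
have /vertex_act_eq[<- //|->] : vertex_act F0 g = vertex_act F0 h.
  exact: vertex_repP.
by rewrite gmulfM conjgM polygon_morph_b proj_rev_b.
Qed.

Lemma reflection_image_act F g :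
  reflection_image (vertex_act F g) = reflection_image F ^ polygon_morph g.
Proof.
by rewrite {1}(vertex_repP F) -vertex_actM reflection_image_base gmulfM conjgM.
Qed.

Lemma reflection_image_sq F : reflection_image F * reflection_image F = 1.
Proof. by rewrite /reflection_image -conjMg proj_rev_sq conj1g. Qed.

Lemma reflection_image0 : reflection_image F0 = t.
Proof. by rewrite -(vertex_act1 F0) reflection_image_base gmulf1 conjg1. Qed.

Lemma reflection_image_vertex j : (0 < j)%N ->
  reflection_image F0 * reflection_image (vertex p j) =
    ext_proj (inC (w j)) ^ x i1.
Proof.
move=> j_gt0; rewrite 2!relator_morph relatorJ ?proj_gen_sq //.
rewrite reflection_image0 reflection_image_base.
rewrite gmulfXn gmulfM polygon_morph_a polygon_morph_b conjgE.
have <- : ((x i2 * x i1) ^+ j)^-1 ^ t = (x i1 * x i0) ^+ j.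
  rewrite -expVgn invgM (mulg1_eq (proj_gen_sq _)) (mulg1_eq (proj_gen_sq _)).
  rewrite conjXg conjMg.
  by rewrite !proj_gen_rev rev_i1 rev_i2.
by rewrite conjgE (mulg1_eq proj_rev_sq) !mulgA.
Qed.

Lemma reflection_image_pair k m g : (0 < k)%N -> N (w k ^+ m) ->
  (reflection_image (vertex_act F0 g) *
   reflection_image (vertex_act (vertex p k) g)) ^+ m = 1.
Proof.
move=> k_gt0 Nwk.
rewrite (reflection_image_act F0) (reflection_image_act (vertex p k)) -conjMg.
rewrite reflection_image_vertex // -!conjXg -!gmulfXn.
by rewrite (proj_inC_eq1 (w k ^+ m)).2 ?conj1g ?conj1g.
Qed.

(** For [k = 1] this is the commutation of the two ends of the diagram. *)
Lemma relator_sq k : (0 < k < p)%N -> N (w k ^+ 2).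
Proof.
case/andP; case: k => [//|[|k] _ kp].
  rewrite /relator /= !expg0 mul1g mulg1 string_rel02.
  exact: (subgroup1 (normal_closure_subgroup _)).
by apply: sub_normal_closure; left; exists k.+2 => //=; lia.
Qed.

(** Up to conjugation the two vertices are the base vertex and the vertex [k].
For [k <= p] the relation is that of the word [w k]; for [k > p] the roles of
the two vertices are exchanged, which replaces [k] by [2 * p - k]. *)
Lemma reflection_imageX F E : F <> E ->
  (reflection_image F * reflection_image E) ^+ M F E = 1.
Proof.
move=> FE; rewrite /twist_matrix; case: eqP => [EF|_]; first by case: FE.
have FP := vertex_repP F; set g := vertex_rep F in FP.
case: eqP => [->|EA].
  rewrite FP -vertex_actM (polygon_alpha_central g) vertex_actM.
  apply: (@reflection_image_pair p); first lia.
  by apply: sub_normal_closure; right.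
have [e [k kn hk]] := polygon_normal_form p_ge2 (vertex_rep E * g^-1).
have EP : E = vertex_act (vertex p k) g.
  rewrite (vertex_repP E) -(mulgVK g (vertex_rep E)) hk vertex_actM.
  congr vertex_act.
  apply/vertex_act_eq.
  by case: e {hk}; rewrite ?expg0 ?expg1 ?mul1g; [right | left].
have k_gt0 : (0 < k)%N.
  by rewrite lt0n; apply/eqP => k0; apply: FE; rewrite EP FP k0 -base_vertex0.
have [kp|pk|kp] := ltngtP k p.
- rewrite EP FP; apply: reflection_image_pair => //.
  by apply: relator_sq; rewrite k_gt0.
- have FE' : F = vertex_act (vertex p (2 * p - k)) (r ^+ k * g).
    rewrite /vertex -vertex_actM mulgA -expgnDr subnK; last exact: ltnW.
    by rewrite polygon_rotX mul1g.
  have EE' : E = vertex_act F0 (r ^+ k * g) by rewrite vertex_actM.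
  apply: involutions_swapX; rewrite ?reflection_image_sq //.
  rewrite EE' FE'; apply: reflection_image_pair; first lia.
  by apply: relator_sq; lia.
- case: EA; rewrite EP FP kp -[RHS]vertex_actM.
  by rewrite (polygon_alpha_central g) vertex_actM.
Qed.

Definition vertex_morph : UMagmaMorphism.type W ext_quotient :=
  cox_lift reflection_image_sq reflection_imageX.

Lemma vertex_morph_sigma F : vertex_morph (sigma s F) = reflection_image F.
Proof. exact: cox_lift_gen. Qed.

Lemma vertex_morph_act y g :
  vertex_morph (twist_act y g) = vertex_morph y ^ polygon_morph g.
Proof.
move: y; apply: cox_ind => [|F y IHy].
  have -> : twist_act (1 : W) g = 1.
    exact: (gact_one (twist_action _ (@polygon_alpha_central p) s)).
  by rewrite gmulf1 conj1g.
rewrite (twist_actM (@polygon_alpha_central p)).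
rewrite (twist_act_gen (@polygon_alpha_central p)) !gmulfM IHy conjMg.
by rewrite !vertex_morph_sigma reflection_image_act.
Qed.

(** The homomorphism from the semidirect product that is assembled from those on
W and on G. *)
Definition two_pow_morph (u : T) : ext_quotient :=
  vertex_morph u.1 * polygon_morph u.2.
Lemma two_pow_morphM : {morph two_pow_morph : u v / u * v}.
Proof.
case=> [y g] [z h]; rewrite /two_pow_morph /= !gmulfM vertex_morph_act.
by rewrite gmulfV conjgE invgK !mulgA mulgVK.
Qed.

Lemma two_pow_morph_tau g : two_pow_morph (tau g) = polygon_morph g.
Proof. by rewrite /two_pow_morph gmulf1 mul1g. Qed.

Lemma two_pow_morph_sigma0 : two_pow_morph S0 = t.
Proof.
rewrite /two_pow_morph gmulf1 mulg1 -reflection_image0.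
exact: vertex_morph_sigma.
Qed.

(** Both sides are homomorphisms with the same values on the generators. So the
morphism from [C] onto the halving group is injective modulo the relators. *)
Lemma two_pow_morph_halving y :
  two_pow_morph (halving_morph y) = ext_proj (inC y).
Proof.
move: y; apply: cox_ind => [|i y IHy].
  by rewrite !gmulf1 -(gmulf1 (s := tau)) two_pow_morph_tau gmulf1.
rewrite !gmulfM two_pow_morphM IHy halving_morph_c; congr (_ * _).
case: (ord3_inordP i) => ->;
  rewrite ?diagram0 ?diagram1 ?diagram2 ?hgen0 ?hgen1 ?hgen2.
- rewrite !two_pow_morphM two_pow_morph_sigma0 two_pow_morph_tau.
  rewrite polygon_morph_a.
  by rewrite -rev_i2 -proj_gen_rev conjgE (mulg1_eq proj_rev_sq) mulgA.
- by rewrite two_pow_morph_tau polygon_morph_b.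
- by rewrite two_pow_morph_tau polygon_morph_a.
Qed.

Lemma halving_morph_kernel y : halving_morph y = 1 <-> N y.
Proof.
split=> [fy|]; last exact: halving_morph_relators.
apply/proj_inC_eq1; rewrite -two_pow_morph_halving fy.
by rewrite -(gmulf1 (s := tau)) two_pow_morph_tau gmulf1.
Qed.
End Presentation.

Theorem proposition3p4 (p s : nat) (p_ge2 : (2 <= p)%N) (s_ge2 : (2 <= s)%N) :
  let rt : 'I_3 -> two_pow_polygon p s :=
    halving_gen (@two_pow_polygon_gen p s) in
  let e : 'I_3 -> 'I_3 := tnth [tuple inord 0; inord 2; inord 1] in
  let H := generated (range rt) in
  let c : 'I_3 -> string_coxeter 3 [:: 2 * p; 2 * p]%N :=
    @string_gen 3 [:: 2 * p; 2 * p]%N in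
  let x0 := c (inord 0) in let x2 := c (inord 1) in let x1 := c (inord 2) in
  let w (j : nat) := (x0 * x2) ^+ j.-1 * x0 * x1 * (x2 * x1) ^+ j.-1 in
  [/\ regular_polytope rt e [:: 2 * p; 2 * p]%N,
      automorphism_group_is_right_mult H (parabolic rt),
      H #= `I_((2 * s) ^ p * (2 * p))%N &
      exists f : {multiplicative string_coxeter 3 [:: 2 * p; 2 * p]%N
                  -> two_pow_polygon p s},
        [/\ forall i, f (c i) = rt (e i),
            range f = H &
            [set x | f x = 1] =
              normal_closure ([set w j ^+ 2 | j in [set j | (2 <= j <= p.-1)%N]]
                `|` [set w p ^+ s])]].
Proof.
split.
- exact: halving_regular_polytope.
- exact: halving_automorphisms.
- exact: card_halving.
exists (halving_morph p_ge2 s_ge2); split.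
- exact: halving_morph_c.
- exact: range_halving_morph.
apply/seteqP; split=> x /=; rewrite inord0.
  by move/halving_morph_kernel.
by move=> Nx; apply/halving_morph_kernel.
Qed.
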